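(* Let $\mathcal{I}$ be an instance of FZA on a path $T$ with edges $e^{(1)},\dots,e^{(n-1)}$ (left to right). Then the optimal revenue of $\mathcal{I}$ equals $\max_X R(e^{(n-1)},X)$, where the maximum is over all vectors $X=(x_i)$ indexed by the commodities $i$ with $e^{(n-1)}\in P_i$ and with $x_i\in\{-\infty,-1,0,1,\dots,u_i\}$; this value can be computed in time $n^{\mathcal{O}(\mathrm{cong}(\mathcal{I}))}$. Consequently, FZA on paths is in XP when parameterized by $\mathrm{cong}(\mathcal{I})$.
   Context: FZA: given a tree $T=(V,E)$ with $n=|V|$, a non-decreasing concave $f\colon\mathbb{N}_0\to\mathbb{R}_{\ge0}$ and commodities $i\in[k]$ with path $P_i\subseteq E$, bound $u_i\in\mathbb{N}_0$ and weight $w_i\in\mathbb{N}$, maximize $\sum_i\mathrm{rev}_i(F)$ over $F\subseteq E$, where $\mathrm{rev}_i(F)=w_if(|P_i\cap F|)$ if $|P_i\cap F|\le u_i$ and $0$ otherwise. Congestion: $\mathrm{cong}(\mathcal{I})=\max_{e\in E}|\{i\in[k]: e\in P_i\}|$. The subinstance up to $e^{(j)}$ consists of the subpath $e^{(1)},\dots,e^{(j)}$ and the commodities whose leftmost edge is $e^{(j)}$ or to its left. For a vector $X$ indexed by the commodities $i$ with $e^{(j)}\in P_i$, $x_i\in\{-\infty,-1,0,\dots,u_i\}$, $R(e^{(j)},X)$ is the maximum revenue obtainable from the subinstance up to $e^{(j)}$ among all solutions that cut exactly $u_i-x_i$ edges of $P_i$ among $e^{(1)},\dots,e^{(j)}$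 for each such $i$ (where $x_i=-\infty$ means at least $u_i+2$ such edges are cut). A parameterized problem is in XP if solvable in time $n^{g(\ell)}$ for some function $g$ of the parameter $\ell$. *)

(* Defs.v *)
From HB Require Import structures.
From mathcomp Require Import all_boot all_order all_algebra.
From mathcomp Require Import reals constructive_ereal.

Set Implicit Arguments.
Unset Strict Implicit.
Unset Printing Implicit Defensive.

Import Order.TTheory GRing.Theory Num.Theory.
Local Open Scope ring_scope.

Section Graph.
Variables (V : finType) (adj : rel V).

Definition edge_set : {set {set V}} :=
  [set [set p.1; p.2] | p : V * V & adj p.1 p.2].

Definition walk_edges (s : seq V) : seq {set V} :=
  [seq [set p.1; p.2] | p <- zip s (behead s)].

Definition is_tree : Prop :=
  [/\ symmetric adj, irreflexive adj, (0 < #|V|)%N,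
      forall x y, connect adj x y &
      forall c : seq V, (2 < size c)%N -> ~ ucycle adj c].

(* Edge sets of simple paths with at least one edge. *)
Definition is_path_edges (P : {set {set V}}) : Prop :=
  exists x p, [/\ p != [::], path adj x p, uniq (x :: p) &
                  P = [set e in walk_edges (x :: p)]].

End Graph.

Record fza (R : realType) := Fza {
  fza_V : finType;
  fza_adj : rel fza_V;
  fza_f : nat -> R;
  fza_k : nat;
  fza_P : 'I_fza_k -> {set {set fza_V}};
  fza_u : 'I_fza_k -> nat;
  fza_w : 'I_fza_k -> nat;
  fza_treeP : is_tree fza_adj;
  fza_f_ge0 : forall m, 0 <= fza_f m;
  fza_f_homo : {homo fza_f : m n / (m <= n)%N >-> m <= n};
  fza_f_concave : forall m,
    fza_f m.+2 - fza_f m.+1 <= fza_f m.+1 - fza_f m;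
  fza_PP : forall i, is_path_edges fza_adj (fza_P i);
  fza_w_gt0 : forall i, (0 < fza_w i)%N }.

Section FZA.
Variables (R : realType) (I : fza R).

Definition fza_n : nat := #|fza_V I|.

Definition fza_E : {set {set fza_V I}} := edge_set (@fza_adj R I).

Definition com_rev (i : 'I_(fza_k I)) (F : {set {set fza_V I}}) : R :=
  if (#|fza_P i :&: F| <= fza_u i)%N
  then (fza_w i)%:R * fza_f I #|fza_P i :&: F| else 0.

Definition revenue (F : {set {set fza_V I}}) : R := \sum_i com_rev i F.

Definition opt : \bar R :=
  \big[maxe/-oo%E]_(F : {set {set fza_V I}} | F \subset fza_E) (revenue F)%:E.

Definition cong : nat := \max_(e in fza_E) #|[set i | e \in @fza_P R I i]|.

End FZA.

(* An instance whose tree is a path; [fp_vs] lists the vertices of the path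
   from left to right. *)
Record fza_path (R : realType) := FzaPath {
  fp_inst :> fza R;
  fp_vs : seq (fza_V fp_inst);
  fp_uniq : uniq fp_vs;
  fp_all : forall x, x \in fp_vs;
  fp_edges : fza_E fp_inst = [set e in walk_edges fp_vs] }.

Section DP.
Variables (R : realType) (I : fza_path R).

Definition edges : seq {set fza_V I} := walk_edges (fp_vs I).

(* e^(j), with 1 <= j <= n - 1 *)
Definition edge (j : nat) : {set fza_V I} := nth set0 edges j.-1.

Definition prefix_edges (j : nat) : {set {set fza_V I}} :=
  [set e in take j edges].

(* 1-based position of the leftmost edge of P_i. *)
Definition leftmost (i : 'I_(fza_k I)) : nat :=
  (find (fun e => e \in fza_P i) edges).+1.

Definition active (j : nat) := {i : 'I_(fza_k I) | edge j \in fza_P i}.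

(* {-oo, -1, 0, ..., u}: [None] stands for -oo, [Some m] for m - 1. *)
Definition xdom (u : nat) := option 'I_u.+2.

Definition xvec (j : nat) :=
  {dffun forall i : active j, xdom (fza_u (val i))}.

(* The number c of edges cut in a path of bound u is described by x. *)
Definition cut_ok (u c : nat) (x : xdom u) : bool :=
  if x is Some m then c%:Z == u%:Z - (m%:Z - 1) else (u.+2 <= c)%N.

Definition compatible (j : nat) (X : xvec j) (F : {set {set fza_V I}}) : bool :=
  [forall i : active j,
    cut_ok #|fza_P (val i) :&: F :&: prefix_edges j| (X i)].

Definition subrevenue (j : nat) (F : {set {set fza_V I}}) : R :=
  \sum_(i | (leftmost i <= j)%N) com_rev i F.

(* -oo if no solution is compatible with X. *)
Definition Rmax (j : nat) (X : xvec j) : \bar R :=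
  \big[maxe/-oo%E]_(F : {set {set fza_V I}} |
      (F \subset prefix_edges j) && compatible X F) (subrevenue j F)%:E.

End DP.

(* A structured real RAM with unit-cost operations. Memory consists of arrays of
   naturals and arrays of reals; array names are program constants, so a program
   uses finitely many arrays. As is usual under unit cost, naturals only have
   addition and truncated subtraction, and reals cannot be converted to
   naturals. *)

Inductive nexp :=
| NConst of nat
| NGet of nat & nexp
| NAdd of nexp & nexp
| NSub of nexp & nexp.

Inductive rexp :=
| RConst of nat
| RGet of nat & nexp
| RAdd of rexp & rexp
| RSub of rexp & rexp
| RMul of rexp & rexp.

Inductive test :=
| NLe of nexp & nexp
| RLe of rexp & rexp.

Inductive cmd :=
| Skip
| NSet of nat & nexp & nexp
| RSet of nat & nexp & rexp
| Seq of cmd & cmd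
| If of test & cmd & cmd
| While of test & cmd.

Record state (R : realType) := State {
  nmem : nat -> nat -> nat;
  rmem : nat -> nat -> R }.

Definition upd (T : Type) (m : nat -> nat -> T) (a i : nat) (v : T) :=
  fun b j => if (b == a) && (j == i) then v else m b j.

Section Semantics.
Variable R : realType.
Implicit Types s : state R.

Fixpoint neval s (e : nexp) : nat :=
  match e with
  | NConst c => c
  | NGet a e1 => nmem s a (neval s e1)
  | NAdd e1 e2 => (neval s e1 + neval s e2)%N
  | NSub e1 e2 => (neval s e1 - neval s e2)%N
  end.

Fixpoint reval s (e : rexp) : R :=
  match e with
  | RConst c => c%:R
  | RGet a e1 => rmem s a (neval s e1)
  | RAdd e1 e2 => reval s e1 + reval s e2
  | RSub e1 e2 => reval s e1 - reval s e2
  | RMul e1 e2 => reval s e1 * reval s e2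
  end.

Definition teval s (b : test) : bool :=
  match b with
  | NLe e1 e2 => (neval s e1 <= neval s e2)%N
  | RLe e1 e2 => reval s e1 <= reval s e2
  end.

Fixpoint ncost (e : nexp) : nat :=
  match e with
  | NConst _ => 1
  | NGet _ e1 => (ncost e1).+1
  | NAdd e1 e2 | NSub e1 e2 => (ncost e1 + ncost e2).+1
  end.

Fixpoint rcost (e : rexp) : nat :=
  match e with
  | RConst _ => 1
  | RGet _ e1 => (ncost e1).+1
  | RAdd e1 e2 | RSub e1 e2 | RMul e1 e2 => (rcost e1 + rcost e2).+1
  end.

Definition tcost (b : test) : nat :=
  match b with
  | NLe e1 e2 => (ncost e1 + ncost e2).+1
  | RLe e1 e2 => (rcost e1 + rcost e2).+1
  end.

(* [exec p s s' t]: started in s, p halts in s' after t steps. *)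
Inductive exec : cmd -> state R -> state R -> nat -> Prop :=
| ExecSkip s : exec Skip s s 1
| ExecNSet s a i e :
    exec (NSet a i e) s
      (State (upd (nmem s) a (neval s i) (neval s e)) (rmem s))
      (ncost i + ncost e).+1
| ExecRSet s a i e :
    exec (RSet a i e) s
      (State (nmem s) (upd (rmem s) a (neval s i) (reval s e)))
      (ncost i + rcost e).+1
| ExecSeq c1 c2 s1 s2 s3 t1 t2 :
    exec c1 s1 s2 t1 -> exec c2 s2 s3 t2 ->
    exec (Seq c1 c2) s1 s3 (t1 + t2)
| ExecIf b c1 c2 s s' t :
    exec (if teval s b then c1 else c2) s s' t ->
    exec (If b c1 c2) s s' (tcost b + t)
| ExecWhileF b c s :
    ~~ teval s b -> exec (While b c) s s (tcost b)
| ExecWhileT b c s1 s2 s3 t1 t2 :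
    teval s1 b -> exec c s1 s2 t1 -> exec (While b c) s2 s3 t2 ->
    exec (While b c) s1 s3 (tcost b + t1 + t2).

End Semantics.

Record input (R : realType) := Input {
  in_nat : seq (seq nat);
  in_real : seq (seq R) }.

Definition init (R : realType) (x : input R) : state R :=
  State (fun a i => nth 0%N (nth [::] (in_nat x) a) i)
        (fun a i => nth 0 (nth [::] (in_real x) a) i).

Definition input_size (R : realType) (x : input R) : nat :=
  (sumn (shape (in_nat x)) + sumn (shape (in_real x)))%N.

Record param_problem (R : realType) := ParamProblem {
  pp_inst : Type;
  pp_input : pp_inst -> input R;
  pp_param : pp_inst -> nat;
  pp_solved : pp_inst -> state R -> Prop }.

Definition in_XP (R : realType) (Q : param_problem R) : Prop :=
  exists (p : cmd) (g : nat -> nat), forall x : pp_inst Q,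
  exists (s : state R) (t : nat),
    [/\ exec p (init (pp_input x)) s t,
        (t <= input_size (pp_input x) ^ g (pp_param x))%N &
        pp_solved x s].

Section Encoding.
Variables (R : realType) (I : fza_path R).

(* Array 2 of naturals is the incidence matrix of commodities and edges, row by
   row, the edges being ordered from left to right. Only the values f(0), ...,
   f(n-1) matter, since |P_i| <= n - 1. *)
Definition fza_input : input R :=
  Input
    [:: [:: fza_n I; fza_k I];
        [seq fza_u i | i <- enum 'I_(fza_k I)];
        [seq nat_of_bool (e \in fza_P i) |
           i <- enum 'I_(fza_k I), e <- edges I]]
    [:: [seq fza_f I m | m <- iota 0 (fza_n I)];
        [seq (fza_w i)%:R | i <- enum 'I_(fza_k I)]].

(* F contains e^(j+1) iff cell j of array 0 of naturals is nonzero. *)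
Definition out_solution (s : state R) : {set {set fza_V I}} :=
  [set e in edges I | nmem s 0 (index e (edges I)) != 0%N].

Definition out_value (s : state R) : R := rmem s 0 0.

End Encoding.

(* Solving FZA means to output a set F of maximum revenue. *)
Definition fza_on_paths (R : realType) : param_problem R :=
  @ParamProblem R (fza_path R) (@fza_input R) (fun I => cong I)
    (fun I s => (revenue (out_solution I s))%:E = opt I).

(* Main.v *)
(** A dynamic program from left to right keeps a list of cut sets of the first
    j edges. Two such sets are interchangeable if they cut every commodity that
    contains edge j equally often: a path avoiding edge j lies on one side of it,
    so every continuation changes both revenues by the same amount. Keeping the
    better one of each such pair leaves at most n^cong sets, and one of them
    extends to an optimum. With quadratic-time pruning, every loop makes at most
    n^(2 cong) rounds, and the loops are nested to a fixed depth. *)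

Require Import Defs.
From HB Require Import structures.
From mathcomp Require Import all_boot all_order all_algebra.
From mathcomp Require Import reals constructive_ereal.
From mathcomp Require Import zify.

Set Implicit Arguments.
Unset Strict Implicit.
Unset Printing Implicit Defensive.

Import Order.TTheory GRing.Theory Num.Theory.
Local Open Scope ring_scope.

(** * Running time and frame rules for the RAM *)

(** The program stores cut sets rather than a table indexed by vectors [X]. This avoids turning
    vectors into addresses on a machine that cannot multiply naturals: equivalence of two sets is
    decided by recounting their cuts. The value kept with a set is its revenue in the whole instance
    when nothing further is cut, so commodities to the right already contribute their [f 0] term.
    This does not distort the pruning, which relies only on differences between equivalent sets.
    Equivalence refers to the edge just decided and therefore changes from stage to stage. What is
    carried along is domination: a representative does at least as well under every continuation. It
    is transitive and survives the decision about the next edge. The time bound is read off the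
    program text, so that correctness proofs only have to bound the rounds of each loop. The formula
    with [Rmax] is independent of the program: it sorts all solutions by their cut counts at the
    last edge. *)

Fixpoint nwrites (c : cmd) : seq nat :=
  match c with
  | Skip | RSet _ _ _ => [::]
  | NSet a _ _ => [:: a]
  | Seq c1 c2 | If _ c1 c2 => nwrites c1 ++ nwrites c2
  | While _ c1 => nwrites c1
  end.

Fixpoint rwrites (c : cmd) : seq nat :=
  match c with
  | Skip | NSet _ _ _ => [::]
  | RSet a _ _ => [:: a]
  | Seq c1 c2 | If _ c1 c2 => rwrites c1 ++ rwrites c2
  | While _ c1 => rwrites c1
  end.

(* Bounds the running time of c if each of its loops makes at most B rounds. *)
Fixpoint time (B : nat) (c : cmd) : nat :=
  match c with
  | Skip => 1
  | NSet _ i e => (ncost i + ncost e).+1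
  | RSet _ i e => (ncost i + rcost e).+1
  | Seq c1 c2 => time B c1 + time B c2
  | If b c1 c2 => tcost b + (time B c1 + time B c2)
  | While b c1 => tcost b + B * (tcost b + time B c1)
  end.

Fixpoint loop_depth (c : cmd) : nat :=
  match c with
  | Skip | NSet _ _ _ | RSet _ _ _ => 0
  | Seq c1 c2 | If _ c1 c2 => maxn (loop_depth c1) (loop_depth c2)
  | While _ c1 => (loop_depth c1).+1
  end.

(** [time B c] is a polynomial in [B] with nonnegative coefficients, of degree at most the loop
    depth, and [time 1 c] is the sum of its coefficients. *)
Lemma time_le_poly (B : nat) (c : cmd) :
  (0 < B)%N -> (time B c <= time 1 c * B ^ loop_depth c)%N.
Proof.
move=> B0.
have le_pow x d e : (d <= e)%N -> (x * B ^ d <= x * B ^ e)%N.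
  by move=> de; rewrite leq_mul2l leq_pexp2l ?orbT.
have le_id x d : (x <= x * B ^ d)%N by rewrite leq_pmulr ?expn_gt0 ?B0.
elim: c => [|a i e|a i e|c1 IH1 c2 IH2|b c1 IH1 c2 IH2|b c IH] /=.
- by rewrite expn0 muln1.
- by rewrite expn0 muln1.
- by rewrite expn0 muln1.
- rewrite mulnDl; apply: leq_add.
    exact: leq_trans IH1 (le_pow _ _ _ (leq_maxl _ _)).
  exact: leq_trans IH2 (le_pow _ _ _ (leq_maxr _ _)).
- rewrite !mulnDl; apply: leq_add; first exact: le_id.
  apply: leq_add.
    exact: leq_trans IH1 (le_pow _ _ _ (leq_maxl _ _)).
  exact: leq_trans IH2 (le_pow _ _ _ (leq_maxr _ _)).
- rewrite mulnDl leq_add ?le_id // mul1n expnS mulnCA leq_mul2l.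
  by rewrite mulnDl leq_add ?orbT ?le_id.
Qed.

Section Runs.
Variable R : realType.
Implicit Types (s : state R) (c : cmd).

Definition agree (ln lr : seq nat) s s' : Prop :=
  (forall a x, a \notin ln -> nmem s' a x = nmem s a x) /\
  (forall a x, a \notin lr -> rmem s' a x = rmem s a x).

Lemma agree_refl ln lr s : agree ln lr s s.
Proof. by []. Qed.

Lemma agree_trans ln lr s1 s2 s3 :
  agree ln lr s1 s2 -> agree ln lr s2 s3 -> agree ln lr s1 s3.
Proof.
by move=> [n1 r1] [n2 r2]; split=> a x ha; rewrite ?n2 ?n1 ?r2 ?r1.
Qed.

Lemma agree_sub ln lr ln' lr' s s' :
  {subset ln <= ln'} -> {subset lr <= lr'} ->
  agree ln lr s s' -> agree ln' lr' s s'.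
Proof.
move=> sn sr [hn hr]; split=> a x ha.
  by apply: hn; apply: contra ha => /sn.
by apply: hr; apply: contra ha => /sr.
Qed.

Lemma exec_agree c s s' t :
  exec c s s' t -> agree (nwrites c) (rwrites c) s s'.
Proof.
elim=> {c s s' t}.
- by move=> s; apply: agree_refl.
- move=> s a i e; split=> //= b x; rewrite inE /upd => /negbTE->.
  by [].
- move=> s a i e; split=> //= b x; rewrite inE /upd => /negbTE->.
  by [].
- move=> c1 c2 s1 s2 s3 t1 t2 _ h1 _ h2; apply: (@agree_trans _ _ _ s2) => /=.
    by apply: agree_sub h1 => x hx; rewrite mem_cat hx.
  by apply: agree_sub h2 => x hx; rewrite mem_cat hx orbT.
- move=> b c1 c2 s s' t _ h; apply: agree_sub h => x /=;
    by case: ifP => _ hx; rewrite mem_cat hx ?orbT.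
- by move=> b c s _; apply: agree_refl.
- by move=> b c s1 s2 s3 t1 t2 _ _ h1 _ h2; apply: agree_trans h1 h2.
Qed.

(** A total-correctness triple. The time allowed depends only on [B] and the program text, so times
    compose without any accounting by the user. *)
Definition runs (B : nat) c s (Q : state R -> Prop) : Prop :=
  exists s' t, [/\ exec c s s' t, (t <= time B c)%N & Q s'].

Lemma runs_frame B c s (Q : state R -> Prop) :
  runs B c s Q ->
  runs B c s (fun s' => agree (nwrites c) (rwrites c) s s' /\ Q s').
Proof.
by case=> s' [t [h1 h2 h3]]; exists s', t; split=> //; split=> //;
  apply: exec_agree h1.
Qed.

Lemma runs_skip B s (Q : state R -> Prop) : Q s -> runs B Skip s Q.
Proof. by move=> h; exists s, 1%N; split=> //; constructor. Qed.

Lemma runs_nset B a i e s (Q : state R -> Prop) :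
  Q (State (upd (nmem s) a (neval s i) (neval s e)) (rmem s)) ->
  runs B (NSet a i e) s Q.
Proof. by move=> h; eexists; eexists; split; [constructor|apply: leqnn|]. Qed.

Lemma runs_rset B a i e s (Q : state R -> Prop) :
  Q (State (nmem s) (upd (rmem s) a (neval s i) (reval s e))) ->
  runs B (RSet a i e) s Q.
Proof. by move=> h; eexists; eexists; split; [constructor|apply: leqnn|]. Qed.

(** The frame of [c1] is handed to the second premise, so [Q1] only has to describe what [c1]
    changes. *)
Lemma runs_seq B c1 c2 s (Q1 Q : state R -> Prop) :
  runs B c1 s Q1 ->
  (forall s1, agree (nwrites c1) (rwrites c1) s s1 -> Q1 s1 -> runs B c2 s1 Q) ->
  runs B (Seq c1 c2) s Q.
Proof.
move=> /runs_frame[s1 [t1 [e1 le1 [ag q1]]]] /(_ s1 ag q1)[s2 [t2 [e2 le2 q2]]].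
by exists s2, (t1 + t2)%N; split=> //; [econstructor; eauto|apply: leq_add].
Qed.

Lemma runs_if B b c1 c2 s (Q : state R -> Prop) :
  (teval s b -> runs B c1 s Q) -> (~~ teval s b -> runs B c2 s Q) ->
  runs B (If b c1 c2) s Q.
Proof.
move=> h1 h2; have [tb|tb] := boolP (teval s b).
  have [s' [t [e le q]]] := h1 tb; exists s', (tcost b + t)%N; split=> //.
    by constructor; rewrite tb.
  by rewrite /= leq_add2l (leq_trans le) ?leq_addr.
have [s' [t [e le q]]] := h2 tb; exists s', (tcost b + t)%N; split=> //.
  by constructor; rewrite (negbTE tb).
by rewrite /= leq_add2l (leq_trans le) ?leq_addl.
Qed.

Lemma runs_mono B c s (Q Q' : state R -> Prop) :
  (forall s', agree (nwrites c) (rwrites c) s s' -> Q s' -> Q' s') ->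
  runs B c s Q -> runs B c s Q'.
Proof.
move=> h /runs_frame[s' [t [e le [ag q]]]].
by exists s', t; split=> //; apply: h.
Qed.

End Runs.

Definition V (a : nat) : nexp := NGet a (NConst 0).

(* Array l keeps the value of e, which c may change. *)
Definition For (v l : nat) (e : nexp) (c : cmd) : cmd :=
  Seq (NSet l (NConst 0) e)
    (Seq (NSet v (NConst 0) (NConst 0))
       (While (NLe (NAdd (V v) (NConst 1)) (V l))
          (Seq c (NSet v (NConst 0) (NAdd (V v) (NConst 1)))))).

Definition setn (R : realType) (s : state R) (a x : nat) : state R :=
  State (upd (nmem s) a 0 x) (rmem s).

(** [J i] holds at the start of round [i]. The body must establish [J i.+1] after the increment of
    the counter, since [J] may read the whole state. *)
Lemma runs_for (R : realType) B v l e c (s : state R)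
    (J : nat -> state R -> Prop) (Q : state R -> Prop) :
  v \notin nwrites c -> l \notin nwrites c -> v != l -> (neval s e <= B)%N ->
  J 0%N (setn (setn s l (neval s e)) v 0) ->
  (forall i s1, (i < neval s e)%N ->
     nmem s1 v 0%N = i ->
     agree (nwrites (For v l e c)) (rwrites (For v l e c)) s s1 ->
     J i s1 -> runs B c s1 (fun s2 => J i.+1 (setn s2 v i.+1))) ->
  (forall s1, agree (nwrites (For v l e c)) (rwrites (For v l e c)) s s1 ->
     J (neval s e) s1 -> Q s1) ->
  runs B (For v l e c) s Q.
Proof.
set N := neval s e; set s0 := setn _ _ _.
move=> vc lc vl NB J0 JS JQ.
set W := While (NLe (NAdd (V v) (NConst 1)) (V l))
          (Seq c (NSet v (NConst 0) (NAdd (V v) (NConst 1)))).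
(* Induction on the number [d] of remaining rounds. The time is kept linear in [d]; only at the end
   is [N] replaced by [B]. *)
have loop d : forall s1, (d <= N)%N -> nmem s1 v 0%N = (N - d)%N ->
    nmem s1 l 0%N = N ->
    agree (nwrites (For v l e c)) (rwrites (For v l e c)) s s1 ->
    J (N - d)%N s1 ->
    exists s2 t, [/\ exec W s1 s2 t,
      (t <= tcost (NLe (NAdd (V v) (NConst 1)) (V l)) +
        d * (tcost (NLe (NAdd (V v) (NConst 1)) (V l)) +
             time B (Seq c (NSet v (NConst 0) (NAdd (V v) (NConst 1))))))%N,
      agree (nwrites (For v l e c)) (rwrites (For v l e c)) s s2 & J N s2].
  elim: d => [|d IH] s1 dN vs ls ag1 j1.
    rewrite subn0 in vs j1; exists s1, (tcost (NLe (NAdd (V v) (NConst 1)) (V l))).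
    split=> //; first (by constructor; rewrite /= vs ls addn1 ltnn); exact: leq_addr.
  have dN' : (N - d.+1 < N)%N by lia.
  have /runs_frame[s2 [t2 [e2 le2 [ag2 j2]]]] := JS _ _ dN' vs ag1 j1.
  have vs2 : nmem s2 v 0%N = (N - d.+1)%N by rewrite ag2.1.
  have eS : (N - d.+1).+1 = (N - d)%N by lia.
  rewrite eS in j2.
  have [|||s3 [t3 [e3 le3 ag3 j3]]] := IH (setn s2 v (N - d)) (ltnW dN) _ _ _ j2.
  - by rewrite /= /upd !eqxx.
  - by rewrite /= /upd eq_sym (negbTE vl) /= ag2.1.
  - apply: (agree_trans ag1); apply: (@agree_trans _ _ _ _ s2).
      apply: agree_sub ag2 => x hx //=; first by rewrite !inE mem_cat hx !orbT.
      by rewrite mem_cat hx.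
    by split=> //= a x; rewrite !inE !negb_or /upd => /and3P[_ /negbTE-> _].
  - exists s3; eexists; split; [apply: ExecWhileT e3|..] => //.
    + by rewrite /= vs ls addn1.
    + apply: ExecSeq e2 _.
      have -> : setn s2 v (N - d) =
          State (upd (nmem s2) v (neval s2 (NConst 0))
             (neval s2 (NAdd (V v) (NConst 1)))) (rmem s2).
        by rewrite /setn /= vs2 addn1 eS.
      exact: ExecNSet.
    + by move: le2 le3 => /=; lia.
have [||||s2 [t2 [e2 le2 ag2 j2]]] := loop N s0 (leqnn _).
- by rewrite /s0 /setn /= /upd !eqxx subnn.
- by rewrite /s0 /setn /= /upd eq_sym (negbTE vl) /= !eqxx.
- split=> //= a x; rewrite !inE !negb_or /upd.
  by move=> /and3P[/negbTE-> /negbTE-> _].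
- by rewrite subnn.
exists s2; eexists; split; last exact: JQ.
  apply: ExecSeq (ExecNSet s l (NConst 0) e) _.
  exact: ExecSeq (ExecNSet (setn s l N) v (NConst 0) (NConst 0)) e2.
have := leq_mul NB (leqnn (tcost (NLe (NAdd (V v) (NConst 1)) (V l)) +
             time B (Seq c (NSet v (NConst 0) (NAdd (V v) (NConst 1)))))%N).
move: le2 => /=; lia.
Qed.

(** * Cut sets of an initial segment *)

Section CutSets.
Variables (R : realType) (m k : nat) (u inc : nat -> nat) (f w : nat -> R).
Implicit Types A G : {set 'I_m}.

Definition nzset (h : nat -> nat) : {set 'I_m} := [set t : 'I_m | h t != 0%N].

Definition pedges (i : nat) : {set 'I_m} := nzset (fun t => inc (m * i + t)).

Definition cuts (i : nat) A : nat := #|pedges i :&: A|.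

Definition set_rev_i (i : nat) A : R :=
  if (cuts i A <= u i)%N then w i * f (cuts i A) else 0.

Definition set_rev A : R := \sum_(i < k) set_rev_i i A.

Definition prefix_set (j : nat) : {set 'I_m} := [set t : 'I_m | (t < j)%N].

(** Counts are compared exactly. This is finer than the vectors [X], which merge all counts above
    [u i + 1], but still leaves at most [m + 1] values per commodity. *)
Definition same_cuts (j : nat) A A' : bool :=
  [forall i : 'I_k, (inc (m * i + j) != 0%N) ==> (cuts i A == cuts i A')].

Definition dominates (j : nat) A' A : Prop :=
  forall G, G \subset ~: prefix_set j -> set_rev (A :|: G) <= set_rev (A' :|: G).

Lemma same_cuts_refl j A : same_cuts j A A.
Proof. by apply/forallP=> i; rewrite eqxx implybT. Qed.

Lemma same_cuts_sym j A A' : same_cuts j A A' = same_cuts j A' A.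
Proof. by apply: eq_forallb => i; rewrite [cuts i A == _]eq_sym. Qed.

Lemma same_cuts_trans j A A' A'' :
  same_cuts j A A' -> same_cuts j A' A'' -> same_cuts j A A''.
Proof.
move=> /forallP h1 /forallP h2; apply/forallP=> i; apply/implyP=> hi.
by rewrite (eqP (implyP (h1 i) hi)) (implyP (h2 i) hi).
Qed.

Lemma dominates_refl j A : dominates j A A.
Proof. by move=> G _. Qed.

Lemma dominates_trans j A A' A'' :
  dominates j A A' -> dominates j A' A'' -> dominates j A A''.
Proof. by move=> h1 h2 G hG; apply: le_trans (h2 G hG) (h1 G hG). Qed.

Lemma cutsU i A G : [disjoint A & G] -> cuts i (A :|: G) = (cuts i A + cuts i G)%N.
Proof.
move=> dAG; rewrite /cuts setIUr cardsU -[RHS]subn0; congr (_ - _)%N.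
apply/eqP; rewrite cards_eq0 setIACA setIid -[X in _ :&: X]/(A :&: G).
by rewrite (disjoint_setI0 dAG) setI0.
Qed.

Hypothesis interval : forall i (t1 t2 t3 : 'I_m), (i < k)%N ->
  (t1 < t2)%N -> (t2 < t3)%N -> t1 \in pedges i -> t3 \in pedges i -> t2 \in pedges i.

(* A commodity avoiding edge j lies on one side of it, hence its revenue
   depends either on A or on G alone. *)
Lemma same_cuts_dominates (j : 'I_m) A A' :
  A \subset prefix_set j.+1 -> A' \subset prefix_set j.+1 ->
  same_cuts j A' A -> set_rev A <= set_rev A' -> dominates j.+1 A' A.
Proof.
move=> sA sA' eqc le G sG.
have dis (X : {set 'I_m}) : X \subset prefix_set j.+1 -> [disjoint X & G].
  move=> sX; rewrite disjoints_subset (subset_trans sX) //.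
  by rewrite -(setCK (prefix_set _)) setCS.
suff E (i : 'I_k) : set_rev_i i (A' :|: G) - set_rev_i i (A :|: G) =
    set_rev_i i A' - set_rev_i i A.
  rewrite -subr_ge0 /set_rev -sumrB (eq_bigr _ (fun i _ => E i)) sumrB subr_ge0.
  exact: le.
have [ij|ij] := boolP (inc (m * i + j) != 0%N).
  have ce : cuts i A' = cuts i A by exact: eqP (implyP (forallP eqc i) ij).
  by rewrite /set_rev_i !cutsU ?dis // ce !subrr.
have jP : j \notin pedges i by rewrite inE.
have c0 (X : {set 'I_m}) : (forall t, t \in X -> t \notin pedges i) -> cuts i X = 0%N.
  move=> h; apply/eqP; rewrite cards_eq0; apply/eqP/setP=> t; rewrite !inE.
  by apply/negbTE/negP=> /andP[t1 /h]; rewrite inE t1.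
have [/existsP[t0 /andP[t0P t0j]]|none] :=
    boolP [exists t : 'I_m, (t \in pedges i) && (t < j)%N].
  have cG : cuts i G = 0%N.
    apply: c0 => t tG; apply/negP=> tP.
    have := subsetP sG _ tG; rewrite !inE -leqNgt => tj.
    move/negP: jP; apply; exact: (interval (ltn_ord i) t0j tj t0P tP).
  by rewrite /set_rev_i !cutsU ?dis // cG !addn0.
have cX (X : {set 'I_m}) : X \subset prefix_set j.+1 -> cuts i X = 0%N.
  move=> sX; apply: c0 => t tX; apply/negP=> tP; have := subsetP sX _ tX.
  rewrite inE ltnS leq_eqVlt => /predU1P[/val_inj tj|tj].
    by rewrite tj (negbTE jP) in tP.
  by move/existsP: none; apply; exists t; rewrite tP.
by rewrite /set_rev_i !cutsU ?dis // (cX A sA) (cX A' sA') !subrr.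
Qed.

(** Edge [j] can be moved from the set into the continuation: if [j] lies in [A], then [A :|: G] is
    [(A :\ j) :|: (j |: G)], and [j |: G] avoids the first [j] edges. The bit is a natural because
    the program writes it into a cell. *)
Lemma dominates_extend (j : 'I_m) A A' (b : nat) :
  A \subset prefix_set j.+1 -> (j \in A) = (b != 0%N) ->
  dominates j A' (A :\ j) ->
  dominates j.+1 (if b != 0%N then j |: A' else A') A.
Proof.
move=> sA jA dom G sG.
have sG' : G \subset ~: prefix_set j.
  by apply: subset_trans sG _; rewrite setCS; apply/subsetP=> t; rewrite !inE; lia.
case: ifP jA => [_ jA|_ jA].
  have /dom : j |: G \subset ~: prefix_set j.
    by rewrite subUset sG' andbT sub1set !inE ltnn.
  by rewrite !setUA ![_ :|: [set j]]setUC setD1K.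
have /dom := sG'; suff -> : A :\ j = A by [].
by apply/setP=> t; rewrite in_setD1; case: eqP => // ->; rewrite jA.
Qed.

Lemma set_rev_ge0 A : (forall x, 0 <= f x) -> (forall x, 0 <= w x) -> 0 <= set_rev A.
Proof.
by move=> f0 w0; apply: sumr_ge0 => i _; rewrite /set_rev_i; case: ifP => // _; apply: mulr_ge0.
Qed.

(** Pigeonhole: pairwise inequivalent sets have different vectors of cut counts, with entries in 0,
    ..., [m], indexed by the at most [c] commodities through edge [j]. *)
Lemma size_distinct (j c len : nat) (h : nat -> {set 'I_m}) :
  (#|[set i : 'I_k | inc (m * i + j) != 0%N]| <= c)%N ->
  (forall q q', (q < q')%N -> (q' < len)%N -> ~~ same_cuts j (h q) (h q')) ->
  (len <= m.+1 ^ c)%N.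
Proof.
set act := [set i : 'I_k | _] => actc hd.
pose F (q : 'I_len) : {ffun {i | i \in act} -> 'I_m.+1} :=
  [ffun i => inord (cuts (val (val i)) (h q))].
have le_cuts i A : (cuts i A < m.+1)%N.
  by rewrite ltnS -[X in (_ <= X)%N]card_ord max_card.
have injF : injective F.
  move=> q q' /ffunP eF.
  have sc : same_cuts j (h q) (h q').
    apply/forallP=> i; apply/implyP=> hi.
    have ia : i \in act by rewrite inE.
    by have /(congr1 val) := eF (exist _ i ia); rewrite !ffunE /= !inordK // => ->.
  apply: val_inj; case: (ltngtP q q') => // hlt.
    by have := hd _ _ hlt (ltn_ord q'); rewrite sc.
  by have := hd _ _ hlt (ltn_ord q); rewrite same_cuts_sym sc.
have := leq_card F injF; rewrite card_ord card_ffun card_ord => /leq_trans; apply.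
by rewrite leq_pexp2l // card_sig (eq_card (B := act)) // => i; rewrite inE.
Qed.

End CutSets.

(** * The program *)

Local Open Scope nat_scope.

(* Arrays of naturals: the input (0, 1, 2); numbers of edges and commodities;
   bounds of the old and the new list; the cut sets as rows of length aM; the
   candidate; counters i* and limits l* of the loops; cuts and their differences;
   starts aIB, aRB, aQB of matrix rows. Arrays of reals: the input (0, 1); the
   revenue of the candidate; the revenues of the rows. *)
Local Notation aOut := 0 (only parsing).
Local Notation aU := 1 (only parsing).
Local Notation aInc := 2 (only parsing).
Local Notation aM := 3 (only parsing).
Local Notation aK := 4 (only parsing).
Local Notation aLo := 5 (only parsing).
Local Notation aHi := 6 (only parsing).
Local Notation aTop := 7 (only parsing).
Local Notation aRow := 8 (only parsing).
Local Notation aCand := 9 (only parsing).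
Local Notation iMul := 10 (only parsing).
Local Notation lMul := 11 (only parsing).
Local Notation iE := 12 (only parsing).
Local Notation lE := 13 (only parsing).
Local Notation iC := 14 (only parsing).
Local Notation lC := 15 (only parsing).
Local Notation iR := 16 (only parsing).
Local Notation lR := 17 (only parsing).
Local Notation iQ := 18 (only parsing).
Local Notation lQ := 19 (only parsing).
Local Notation iJ := 20 (only parsing).
Local Notation lJ := 21 (only parsing).
Local Notation aIB := 22 (only parsing).
Local Notation aC1 := 23 (only parsing).
Local Notation aC2 := 24 (only parsing).
Local Notation aDiff := 25 (only parsing).
Local Notation aRB := 26 (only parsing).
Local Notation aQB := 27 (only parsing).
Local Notation aR := 28 (only parsing).
Local Notation aQ := 29 (only parsing).
Local Notation aFound := 30 (only parsing).
Local Notation rF := 0 (only parsing).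
Local Notation rW := 1 (only parsing).
Local Notation rVal := 2 (only parsing).
Local Notation rRev := 3 (only parsing).

Local Notation cst := NConst (only parsing).
Local Notation "a ':=n' e" := (NSet a (NConst 0) e) (at level 70).
Local Notation "c1 ;; c2" := (Seq c1 c2) (at level 75, right associativity).

(** Row addresses need a product, obtained here by repeated addition at the price of one more
    loop. *)
Definition mul_m (d a : nat) : cmd :=
  d :=n cst 0 ;; For iMul lMul (V aM) (d :=n NAdd (V d) (V a)).

(* cuts of commodity iC in the row starting at aRB and in the candidate *)
Definition count2 : cmd :=
  aC1 :=n cst 0 ;; aC2 :=n cst 0 ;;
  For iE lE (V aM)
    (If (NLe (cst 1) (NGet aInc (NAdd (V aIB) (V iE))))
       (If (NLe (cst 1) (NGet aRow (NAdd (V aRB) (V iE))))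
           (aC1 :=n NAdd (V aC1) (cst 1)) Skip ;;
        If (NLe (cst 1) (NGet aCand (V iE)))
           (aC2 :=n NAdd (V aC2) (cst 1)) Skip)
       Skip).

Definition cand_revenue : cmd :=
  RSet rVal (cst 0) (RConst 0) ;;
  For iC lC (V aK)
    (mul_m aIB iC ;; count2 ;;
     If (NLe (V aC2) (NGet aU (V iC)))
        (RSet rVal (cst 0)
           (RAdd (RGet rVal (cst 0))
                 (RMul (RGet rW (V iC)) (RGet rF (V aC2)))))
        Skip).

(* aDiff becomes 0 iff the row starting at aRB and the candidate have the same
   cuts on all commodities that contain edge iJ. *)
Definition compare : cmd :=
  aDiff :=n cst 0 ;;
  For iC lC (V aK)
    (mul_m aIB iC ;;
     If (NLe (cst 1) (NGet aInc (NAdd (V aIB) (V iJ))))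
        (count2 ;;
         aDiff :=n NAdd (V aDiff)
                     (NAdd (NSub (V aC1) (V aC2)) (NSub (V aC2) (V aC1))))
        Skip).

Definition store : cmd :=
  For iE lE (V aM) (NSet aRow (NAdd (V aRB) (V iE)) (NGet aCand (V iE))).

Definition load : cmd :=
  For iE lE (V aM) (NSet aCand (V iE) (NGet aRow (NAdd (V aQB) (V iE)))).

Definition output : cmd :=
  For iE lE (V aM) (NSet aOut (V iE) (NGet aRow (NAdd (V aQB) (V iE)))).

Definition insert : cmd :=
  aFound :=n cst 0 ;;
  For iR lR (NSub (V aTop) (V aHi))
    (aR :=n NAdd (V aHi) (V iR) ;;
     mul_m aRB aR ;;
     compare ;;
     If (NLe (V aDiff) (cst 0))
        (aFound :=n cst 1 ;;
         If (RLe (RGet rRev (V aR)) (RGet rVal (cst 0)))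
            (store ;; RSet rRev (V aR) (RGet rVal (cst 0))) Skip)
        Skip) ;;
  If (NLe (V aFound) (cst 0))
     (mul_m aRB aTop ;;
      store ;;
      RSet rRev (V aTop) (RGet rVal (cst 0)) ;;
      aTop :=n NAdd (V aTop) (cst 1))
     Skip.

Definition try_bit (b : nat) : cmd :=
  load ;; NSet aCand (V iJ) (cst b) ;; cand_revenue ;; insert.

(* The rows aLo, ..., aHi - 1 are cut sets of the edges before iJ; their
   extensions by edge iJ are collected in the rows aHi, ..., aTop - 1. *)
Definition stage : cmd :=
  For iQ lQ (NSub (V aHi) (V aLo))
    (aQ :=n NAdd (V aLo) (V iQ) ;;
     mul_m aQB aQ ;;
     try_bit 0 ;;
     try_bit 1) ;;
  aLo :=n V aHi ;;
  aHi :=n V aTop.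

(** The outputs share their arrays with the input sizes and the table of [f]. These may be
    overwritten only now, when the sizes have been copied and all revenues are stored. *)
Definition select_best : cmd :=
  RSet 0 (cst 0) (RConst 0) ;;
  For iQ lQ (NSub (V aHi) (V aLo))
    (aQ :=n NAdd (V aLo) (V iQ) ;;
     If (RLe (RGet 0 (cst 0)) (RGet rRev (V aQ)))
        (mul_m aQB aQ ;;
         RSet 0 (cst 0) (RGet rRev (V aQ)) ;;
         output)
        Skip).

(** The branch for zero commodities is forced by the time bound: the congestion is then 0, which
    allows each loop only one round, possibly fewer than there are edges. *)
Definition fza_prog : cmd :=
  If (NLe (NGet 0 (cst 1)) (cst 0))
     (RSet 0 (cst 0) (RConst 0))
     (aM :=n NSub (NGet 0 (cst 0)) (cst 1) ;;
      aK :=n NGet 0 (cst 1) ;;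
      aLo :=n cst 0 ;; aHi :=n cst 1 ;; aTop :=n cst 1 ;;
      cand_revenue ;;
      RSet rRev (cst 0) (RGet rVal (cst 0)) ;;
      For iJ lJ (V aM) stage ;;
      select_best).

(** * Correctness of the counting, comparing and copying routines *)

Section Spec.
Variables (R : realType) (m k B : nat) (u inc : nat -> nat) (f w : nat -> R).
Hypotheses (mB : m <= B) (kB : k <= B).
Implicit Types s : state R.

Local Notation cutsI := (cuts inc).
Local Notation revI := (set_rev k u inc f w).
Local Notation sameI := (same_cuts k inc).
Local Notation domI := (dominates k u inc f w).

Definition base_row s (b : nat) : {set 'I_m} :=
  nzset m (fun t => nmem s aRow (b + t)).
Definition row s (q : nat) : {set 'I_m} := base_row s (m * q).
Definition cand s : {set 'I_m} := nzset m (nmem s aCand).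

Record env s : Prop := Env {
  env_m : nmem s aM 0 = m;
  env_k : nmem s aK 0 = k;
  env_u : forall x, nmem s aU x = u x;
  env_inc : forall x, nmem s aInc x = inc x;
  env_f : forall x, rmem s rF x = f x;
  env_w : forall x, rmem s rW x = w x }.

Lemma env_agree ln lr s s' : agree ln lr s s' ->
  ~~ has (mem ln) [:: aU; aInc; aM; aK] -> ~~ has (mem lr) [:: rF; rW] ->
  env s -> env s'.
Proof.
move=> [agn agr] /= /norP[n1 /norP[n2 /norP[n3 /norP[n4 _]]]].
move=> /norP[r0 /norP[r1 _]] [e1 e2 e3 e4 e5 e6].
by split=> *; rewrite ?agn ?agr.
Qed.

Lemma runs_nset_seq C a i e c s (Q : state R -> Prop) :
  runs C c (State (upd (nmem s) a (neval s i) (neval s e)) (rmem s)) Q ->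
  runs C (NSet a i e ;; c) s Q.
Proof.
move=> h; apply: (@runs_seq _ _ _ _ _
  (eq (State (upd (nmem s) a (neval s i) (neval s e)) (rmem s)))).
  exact: runs_nset.
by move=> s1 _ <-.
Qed.

Lemma runs_rset_seq C a i e c s (Q : state R -> Prop) :
  runs C c (State (nmem s) (upd (rmem s) a (neval s i) (reval s e))) Q ->
  runs C (RSet a i e ;; c) s Q.
Proof.
move=> h; apply: (@runs_seq _ _ _ _ _
  (eq (State (nmem s) (upd (rmem s) a (neval s i) (reval s e))))).
  exact: runs_rset.
by move=> s1 _ <-.
Qed.

Lemma mul_mP d a s :
  d \notin [:: a; iMul; lMul; aM] -> a \notin [:: iMul; lMul] ->
  nmem s aM 0 = m ->
  runs B (mul_m d a) s (fun s' => nmem s' d 0 = m * nmem s a 0).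
Proof.
rewrite !inE !negb_or => /and4P[da d1 d2 d3] /andP[a1 a2] em.
apply: runs_nset_seq.
apply: (@runs_for _ _ _ _ _ _ _ (fun i s1 => nmem s1 d 0 = i * nmem s a 0)) => /=.
- by rewrite inE eq_sym.
- by rewrite inE eq_sym.
- by [].
- by rewrite /upd eq_sym (negbTE d3) /= em.
- by rewrite /upd (negbTE d1) (negbTE d2) /= eqxx.
- move=> i s1 _ _ ag js; apply: runs_nset; rewrite /= /upd (negbTE d1) /= !eqxx /=.
  rewrite js ag.1 ?inE ?negb_or ?a1 ?a2 ?[a == d]eq_sym ?da //=.
  by rewrite /upd eq_sym (negbTE da) /= mulSn addnC.
- by move=> s1 _; rewrite /upd eq_sym (negbTE d3) /= em.
Qed.


Lemma cuts_nzset i h :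
  cutsI i (nzset m h) = \sum_(t < m) ((inc (m * i + t) != 0) && (h t != 0)).
Proof.
rewrite /cuts -sum1_card big_mkcond /=; apply: eq_bigr => t _.
by rewrite !inE; case: (_ && _).
Qed.

Lemma count2P i s : env s -> nmem s aIB 0 = m * i ->
  runs B count2 s (fun s' => nmem s' aC1 0 = cutsI i (base_row s (nmem s aRB 0)) /\
                             nmem s' aC2 0 = cutsI i (cand s)).
Proof.
move=> es ei; do 2!apply: runs_nset_seq.
pose a1 x : bool := (inc (m * i + x) != 0) && (nmem s aRow (nmem s aRB 0 + x) != 0).
pose a2 x : bool := (inc (m * i + x) != 0) && (nmem s aCand x != 0).
apply: (@runs_for _ _ _ _ _ _ _ (fun t s1 =>
  nmem s1 aC1 0 = \sum_(x < t) a1 x /\ nmem s1 aC2 0 = \sum_(x < t) a2 x)) => //=.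
- by rewrite /upd /= env_m.
- by rewrite !big_ord0.
- move=> t s1 _ vt ag [c1 c2].
  rewrite !big_ord_recr /= -{}c1 -{}c2 /a1 /a2.
  rewrite -(env_inc es) -ei.
  have eB : nmem s1 aRB 0 = nmem s aRB 0 by rewrite ag.1.
  have eI : nmem s1 aIB 0 = nmem s aIB 0 by rewrite ag.1.
  have eR x : nmem s1 aRow x = nmem s aRow x by rewrite ag.1.
  have eC x : nmem s1 aCand x = nmem s aCand x by rewrite ag.1.
  have eN x : nmem s1 aInc x = nmem s aInc x by rewrite ag.1.
  rewrite -eB -eI -eR -eC -eN.
  apply: runs_if => /=; rewrite vt lt0n; last first.
    by move=> /negbTE->; apply: runs_skip; rewrite /= /upd /= !addn0.
  move=> -> /=.
  apply: (@runs_seq _ _ _ _ _ (fun s2 =>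
    nmem s2 aC1 0 = nmem s1 aC1 0 + (nmem s1 aRow (nmem s1 aRB 0 + t) != 0))).
    apply: runs_if => /=; rewrite vt lt0n.
      by move=> ->; apply: runs_nset.
    by move=> /negbTE->; apply: runs_skip; rewrite addn0.
  move=> s2 ag2 h2.
  have eC2 x : nmem s2 aCand x = nmem s1 aCand x by rewrite ag2.1.
  have e12 : nmem s2 iE 0 = t by rewrite ag2.1.
  have e24 : nmem s2 aC2 0 = nmem s1 aC2 0 by rewrite ag2.1.
  apply: runs_if => /=; rewrite e12 eC2 lt0n.
    by move=> ->; apply: runs_nset; rewrite /= /upd /= h2 e24.
  by move=> /negbTE->; apply: runs_skip; rewrite /= /upd /= h2 e24 addn0.
- by move=> s1 _; rewrite /upd /= (env_m es) /cand !cuts_nzset.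
Qed.

Lemma env_set s a i x : a \notin [:: aU; aInc; aM; aK] ->
  env s -> env (State (upd (nmem s) a i x) (rmem s)).
Proof.
rewrite !inE !negb_or ![a == _]eq_sym.
move=> /and4P[/negbTE n1 /negbTE n2 /negbTE n3 /negbTE n4] [e1 e2 e3 e4 e5 e6].
by split=> //= *; rewrite /upd ?n1 ?n2 ?n3 ?n4 ?e1 ?e2 ?e3 ?e4 ?e5 ?e6.
Qed.

Lemma cand_revenueP s : env s ->
  runs B cand_revenue s (fun s' => rmem s' rVal 0 = revI (cand s)).
Proof.
move=> es; apply: runs_rset_seq.
apply: (@runs_for _ _ _ _ _ _ _ (fun t s1 =>
  rmem s1 rVal 0 = (\sum_(x < t) set_rev_i u inc f w x (cand s))%R)) => //=.
- by rewrite env_k.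
- by rewrite big_ord0.
- move=> i s1 ik vi ag js.
  have es1 : env s1 by apply: env_agree ag _ _ _ => //; case: es.
  apply: runs_seq; first exact: (mul_mP _ _ (env_m es1)).
  move=> s2 ag2; rewrite vi => e2.
  have es2 : env s2 by apply: env_agree ag2 _ _ _.
  apply: runs_seq; first exact: (count2P es2 e2).
  move=> s3 ag3 [_ c2].
  have es3 : env s3 by apply: env_agree ag3 _ _ _.
  have ec : cand s2 = cand s.
    by apply/setP=> x; rewrite !inE ag2.1 // ag.1.
  have vi3 : nmem s3 iC 0 = i by rewrite ag3.1 // ag2.1.
  have er : rmem s3 rVal 0 = rmem s1 rVal 0 by rewrite ag3.2 // ag2.2.
  rewrite big_ord_recr /= -js /set_rev_i.
  apply: runs_if => /=; rewrite vi3 c2 ec env_u //.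
    move=> ->; apply: runs_rset; rewrite /= /upd /= er vi3 c2 ec.
    by rewrite env_f // env_w.
  by move=> /negbTE->; apply: runs_skip; rewrite /= addr0.
- by move=> s1 _; rewrite env_k.
Qed.

Lemma compareP j s : env s -> nmem s iJ 0 = j ->
  runs B compare s (fun s' =>
    (nmem s' aDiff 0 == 0) = sameI j (base_row s (nmem s aRB 0)) (cand s)).
Proof.
move=> es ej; apply: runs_nset_seq.
set b := base_row _ _.
pose D i := if inc (m * i + j) != 0 then
   (cutsI i b - cutsI i (cand s)) + (cutsI i (cand s) - cutsI i b) else 0.
apply: (@runs_for _ _ _ _ _ _ _ (fun t s1 =>
  nmem s1 aDiff 0 = \sum_(x < t) D x)) => //=.
- by rewrite /upd /= env_k.
- by rewrite big_ord0.
- move=> i s1 ik vi ag js.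
  have es1 : env s1.
    by apply: env_agree ag _ _ _ => //; apply: env_set.
  apply: runs_seq; first exact: (mul_mP _ _ (env_m es1)).
  move=> s2 ag2; rewrite vi => e2.
  have es2 : env s2 by apply: env_agree ag2 _ _ _.
  have ej2 : nmem s2 iJ 0 = j by rewrite ag2.1 // ag.1.
  have ed : nmem s2 aDiff 0 = nmem s1 aDiff 0 by rewrite ag2.1.
  rewrite big_ord_recr /= -js /D.
  apply: runs_if => /=; rewrite e2 ej2 env_inc // lt0n; last first.
    by move=> /negbTE->; apply: runs_skip; rewrite /= /upd /= addn0.
  move=> ->; apply: runs_seq; first exact: (count2P es2 e2).
  move=> s3 ag3 [c1 c2]; apply: runs_nset; rewrite /= /upd /= c1 c2.
  rewrite ag3.1 // ed.
  have -> : cand s2 = cand s by apply/setP=> x; rewrite !inE ag2.1 // ag.1.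
  suff -> : base_row s2 (nmem s2 aRB 0) = b by [].
  by apply/setP=> x; rewrite !inE !ag2.1 // !ag.1.
- move=> s1 _; rewrite /upd /= (env_k es) => ->.
  (* The two truncated differences add up to the distance of the counts, so the sum vanishes exactly
     if all relevant counts agree. *)
  rewrite sum_nat_eq0; apply: eq_forallb => i /=.
  by rewrite /D; case: (_ != 0) => //=; rewrite addn_eq0 !subn_eq0 -eqn_leq.
Qed.

(** Row-major addresses do not collide, so writing one row leaves the others intact. *)
Lemma rc_inj q q' x x' : x < m -> x' < m ->
  (m * q + x == m * q' + x') = (q == q') && (x == x').
Proof.
move=> hx hx'; have m0 : 0 < m by lia.
apply/eqP/andP=> [e|[/eqP-> /eqP->]//].
have e1 : q = q'.
  have : (m * q + x) %/ m = (m * q' + x') %/ m by rewrite e.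
  by rewrite ![m * _]mulnC !divnMDl // !divn_small // !addn0.
by move: e; rewrite e1 => /addnI->; rewrite !eqxx.
Qed.

Lemma storeP r s : nmem s aM 0 = m -> nmem s aRB 0 = m * r ->
  runs B store s (fun s' => row s' r = cand s /\
    forall q, q != r -> row s' q = row s q).
Proof.
move=> em er.
apply: (@runs_for _ _ _ _ _ _ _ (fun t s1 => forall q x, x < m ->
   nmem s1 aRow (m * q + x) =
   if (q == r) && (x < t) then nmem s aCand x else nmem s aRow (m * q + x))) => //=.
- by rewrite em.
- by move=> q x _; rewrite ltn0 andbF.
- move=> t s1 tm vt ag js; apply: runs_nset => q x xm.
  rewrite em in tm.
  have eC y : nmem s1 aCand y = nmem s aCand y by rewrite ag.1.
  have eB : nmem s1 aRB 0 = m * r by rewrite ag.1.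
  rewrite /= /upd /= vt eB rc_inj // ltnS js // eC.
  by case: (q == r) => //=; case: (ltngtP x t) => // ->.
- rewrite em => s1 _ js; split.
    by apply/setP=> x; rewrite !inE js // eqxx ltn_ord.
  by move=> q /negbTE qr; apply/setP=> x; rewrite !inE js // qr.
Qed.

Lemma loadP q s : nmem s aM 0 = m -> nmem s aQB 0 = m * q ->
  runs B load s (fun s' => cand s' = row s q).
Proof.
move=> em er.
apply: (@runs_for _ _ _ _ _ _ _ (fun t s1 => forall x, x < t ->
   nmem s1 aCand x = nmem s aRow (m * q + x))) => //=.
- by rewrite em.
- move=> t s1 tm vt ag js; apply: runs_nset => x xt.
  have eC y : nmem s1 aRow y = nmem s aRow y by rewrite ag.1.
  have eB : nmem s1 aQB 0 = m * q by rewrite ag.1.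
  rewrite /= /upd /= vt eB eC; case: eqP => [->//|xnt]; apply: js; lia.
- by rewrite em => s1 _ js; apply/setP=> x; rewrite !inE js.
Qed.

Lemma outputP q s : nmem s aM 0 = m -> nmem s aQB 0 = m * q ->
  runs B output s (fun s' => nzset m (nmem s' aOut) = row s q).
Proof.
move=> em er.
apply: (@runs_for _ _ _ _ _ _ _ (fun t s1 => forall x, x < t ->
   nmem s1 aOut x = nmem s aRow (m * q + x))) => //=.
- by rewrite em.
- move=> t s1 tm vt ag js; apply: runs_nset => x xt.
  have eC y : nmem s1 aRow y = nmem s aRow y by rewrite ag.1.
  have eB : nmem s1 aQB 0 = m * q by rewrite ag.1.
  rewrite /= /upd /= vt eB eC; case: eqP => [->//|xnt]; apply: js; lia.
- by rewrite em => s1 _ js; apply/setP=> x; rewrite !inE js.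
Qed.

Lemma row_agree ln lr s s' q : agree ln lr s s' -> aRow \notin ln ->
  row s' q = row s q.
Proof. by move=> ag h; apply/setP=> x; rewrite !inE ag.1. Qed.

Lemma cand_agree ln lr s s' : agree ln lr s s' -> aCand \notin ln ->
  cand s' = cand s.
Proof. by move=> ag h; apply/setP=> x; rewrite !inE ag.1. Qed.

(** * Invariants of the list of representatives *)

Hypothesis distinctB : forall (j : 'I_m) (h : nat -> {set 'I_m}) len,
  (forall q q', q < q' -> q' < len -> ~~ sameI j (h q) (h q')) -> len <= B.
Hypothesis interval : forall i (t1 t2 t3 : 'I_m), i < k -> t1 < t2 -> t2 < t3 ->
  t1 \in pedges m inc i -> t3 \in pedges m inc i -> t2 \in pedges m inc i.
Hypothesis f_ge0 : forall x, (0 <= f x)%R.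
Hypothesis w_ge0 : forall x, (0 <= w x)%R.

Definition rows_ok j lo hi s : Prop := forall q, lo <= q < hi ->
  row s q \subset prefix_set m j /\ rmem s rRev q = revI (row s q).

Definition rows_distinct j lo hi s : Prop := forall q q',
  lo <= q -> q < q' -> q' < hi -> ~~ sameI j (row s q) (row s q').

(** New rows are written behind the old list, whose rows must survive because later extensions are
    still read from them. *)
Definition same_rows hi s s' : Prop := forall q, q < hi ->
  row s' q = row s q /\ rmem s' rRev q = rmem s rRev q.

(** This is the condition the program can test and maintain; [same_cuts_dominates] later turns it
    into domination. *)
Definition covered j lo hi s A : Prop := exists q,
  [/\ lo <= q < hi, sameI j (row s q) A & (revI A <= revI (row s q))%R].

Lemma eq_rows_ok j lo hi s s' : (forall q, row s' q = row s q) ->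
  (forall q, rmem s' rRev q = rmem s rRev q) ->
  rows_ok j lo hi s -> rows_ok j lo hi s'.
Proof. by move=> er ev ok q /ok; rewrite er ev. Qed.

Lemma eq_rows_distinct j lo hi s s' : (forall q, row s' q = row s q) ->
  rows_distinct j lo hi s -> rows_distinct j lo hi s'.
Proof. by move=> er dist q q'; rewrite !er; apply: dist. Qed.

Lemma eq_covered j lo hi s s' A : (forall q, row s' q = row s q) ->
  covered j lo hi s A -> covered j lo hi s' A.
Proof. by move=> er [q hq]; exists q; rewrite er. Qed.

Lemma eq_same_rows hi s s1 s2 : (forall q, row s2 q = row s1 q) ->
  (forall q, rmem s2 rRev q = rmem s1 rRev q) ->
  same_rows hi s s1 -> same_rows hi s s2.
Proof. by move=> er ev same q /same; rewrite er ev. Qed.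

Section Update.
Variables (j lo hi r : nat) (s s' : state R) (A : {set 'I_m}).
Hypotheses (ok : rows_ok j.+1 lo hi s) (dist : rows_distinct j lo hi s).
Hypotheses (rA : row s' r = A) (vA : rmem s' rRev r = revI A).
Hypothesis others : forall q, q != r ->
  row s' q = row s q /\ rmem s' rRev q = rmem s rRev q.

Lemma replace_row_ok : A \subset prefix_set m j.+1 -> rows_ok j.+1 lo hi s'.
Proof.
move=> sA q qlh; have [->|/others[-> ->]] := eqVneq q r; first by rewrite rA vA.
exact: ok.
Qed.

Lemma replace_row_distinct : sameI j (row s r) A ->
  rows_distinct j lo hi s'.
Proof.
move=> sc q q' h1 h2 h3.
have := dist h1 h2 h3; apply: contra.
have [->|/others[-> _]] := eqVneq q r; have [->|/others[-> _]] := eqVneq q' r.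
- by rewrite !same_cuts_refl.
- by rewrite rA; exact: same_cuts_trans sc.
- by rewrite rA => h; apply: same_cuts_trans h _; rewrite same_cuts_sym.
- by [].
Qed.

Lemma replace_row_covered C : sameI j (row s r) A ->
  (revI (row s r) <= revI A)%R -> covered j lo hi s C -> covered j lo hi s' C.
Proof.
move=> sc le [q [qlh qC leC]]; exists q; split=> //.
  have [qr|/others[-> _]//] := eqVneq q r; rewrite qr rA.
  by apply: same_cuts_trans (_ : sameI j A (row s r)) _; [rewrite same_cuts_sym|rewrite -qr].
have [qr|/others[-> _]//] := eqVneq q r; rewrite qr rA.
by apply: le_trans le; rewrite -qr.
Qed.

Lemma append_row_ok : A \subset prefix_set m j.+1 -> r = hi ->
  rows_ok j.+1 lo hi.+1 s'.
Proof.
move=> sA rhi q /andP[lq qh]; have [->|qr] := eqVneq q r; first by rewrite rA vA.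
have [-> ->] := others qr; apply: ok; rewrite rhi in qr.
by rewrite lq /=; lia.
Qed.

Lemma append_row_distinct : r = hi ->
  (forall q, lo <= q < hi -> ~~ sameI j (row s q) A) ->
  rows_distinct j lo hi.+1 s'.
Proof.
move=> rhi hA q q' h1 h2 h3.
have qr : q != r by lia.
have [-> _] := others qr.
have [->|qr'] := eqVneq q' r; first by rewrite rA hA // h1 /=; lia.
by have [-> _] := others qr'; apply: dist => //; lia.
Qed.

Lemma append_row_covered C : r = hi ->
  covered j lo hi s C -> covered j lo hi.+1 s' C.
Proof.
move=> rhi [q [/andP[lq qh] qC leC]]; exists q.
have qr : q != r by lia.
by have [-> _] := others qr; split=> //; rewrite lq /= ltnW.
Qed.

End Update.

Definition inserted j hi A s s' : Prop :=
  let top := nmem s aTop 0 in let top' := nmem s' aTop 0 in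
  [/\ hi <= top', rows_ok j.+1 hi top' s' /\ rows_distinct j hi top' s',
      forall C, covered j hi top s C -> covered j hi top' s' C,
      covered j hi top' s' A & same_rows hi s s'].

(** A row is only ever replaced by an equivalent set of at least its revenue, so by transitivity
    nothing loses its cover and distinctness persists. The flag records which alternative holds: if
    set, some row covers the candidate; if clear, all rows tested so far are inequivalent to it,
    which is what appending requires. *)
Lemma insertP (j : 'I_m) hi s : env s -> nmem s iJ 0 = j -> nmem s aHi 0 = hi ->
  hi <= nmem s aTop 0 -> rows_ok j.+1 hi (nmem s aTop 0) s ->
  rows_distinct j hi (nmem s aTop 0) s ->
  cand s \subset prefix_set m j.+1 -> rmem s rVal 0 = revI (cand s) ->
  runs B insert s (inserted j hi (cand s) s).
Proof.
set top := nmem s aTop 0.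
move=> es ej ehi htop ok dist scand vcand; apply: runs_nset_seq.
set s0 := State _ _.
have es0 : env s0 by apply: env_set.
(* Distinctness of the rows bounds the length of the list, hence the rounds of the search. *)
have lenB : top - hi <= B.
  apply: (@distinctB j (fun q => row s (hi + q))) => q q' h1 h2.
  by apply: dist; lia.
apply: (@runs_seq _ _ _ _ _ (fun s1 =>
  [/\ rows_ok j.+1 hi top s1 /\ rows_distinct j hi top s1,
      forall C, covered j hi top s C -> covered j hi top s1 C,
      nmem s1 aFound 0 != 0 -> covered j hi top s1 (cand s),
      nmem s1 aFound 0 = 0 -> forall q, hi <= q < top ->
        ~~ sameI j (row s1 q) (cand s) &
      same_rows hi s s1])).
  apply: (@runs_for _ _ _ _ _ _ _ (fun t s1 =>
    [/\ rows_ok j.+1 hi top s1 /\ rows_distinct j hi top s1,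
      forall C, covered j hi top s C -> covered j hi top s1 C,
      nmem s1 aFound 0 != 0 -> covered j hi top s1 (cand s),
      nmem s1 aFound 0 = 0 -> forall q, hi <= q < hi + t ->
        ~~ sameI j (row s1 q) (cand s) &
      same_rows hi s s1])) => //=.
  - by rewrite /upd /= ehi.
  - by split=> // _ q; lia.
  - rewrite /upd /= ehi -/top => t s1 ttop vt ag [[ok1 dist1] cov1 fnd1 nfnd1 same1].
    have es1 : env s1 by apply: env_agree ag _ _ _.
    have ehi1 : nmem s1 aHi 0 = hi by rewrite ag.1.
    have ej1 : nmem s1 iJ 0 = j by rewrite ag.1.
    have ec1 : cand s1 = cand s by rewrite (cand_agree ag).
    have ev1 : rmem s1 rVal 0 = revI (cand s) by rewrite ag.2.
    apply: runs_nset_seq; rewrite /= ehi1 vt.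
    set s1' := State _ _.
    have es1' : env s1' by apply: env_set.
    apply: runs_seq; first exact: (mul_mP _ _ (env_m es1')).
    move=> s2 ag2; rewrite -[nmem s1' aR 0]/(hi + t) => eb2.
    have es2 : env s2 by apply: env_agree ag2 _ _ _.
    have ej2 : nmem s2 iJ 0 = j by rewrite ag2.1.
    apply: runs_seq; first exact: (compareP es2 ej2).
    move=> s3 ag3; rewrite eb2 -[base_row _ _]/(row s2 (hi + t)).
    rewrite (row_agree _ ag2) // (cand_agree ag2) // -[cand s1']/(cand s1) ec1.
    rewrite -[row s1' _]/(row s1 (hi + t)) => ed.
    have es3 : env s3 by apply: env_agree ag3 _ _ _.
    have er3 q : row s3 q = row s1 q.
      by rewrite (row_agree _ ag3) // (row_agree _ ag2).
    have ec3 : cand s3 = cand s.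
      by rewrite (cand_agree ag3) // (cand_agree ag2).
    have ev3 q : rmem s3 rRev q = rmem s1 rRev q by rewrite ag3.2 // ag2.2.
    have eval3 : rmem s3 rVal 0 = revI (cand s) by rewrite ag3.2 // ag2.2.
    have eb3 : nmem s3 aRB 0 = m * (hi + t) by rewrite ag3.1.
    have ea3 : nmem s3 aR 0 = hi + t by rewrite ag3.1 // ag2.1.
    have ef3 : nmem s3 aFound 0 = nmem s1 aFound 0 by rewrite ag3.1 // ag2.1.
    have rlh : hi <= hi + t < top by lia.
    apply: runs_if => /=; rewrite leqn0 ed; last first.
      move=> nsc; apply: runs_skip; split.
      + by split; [apply: eq_rows_ok ok1|apply: eq_rows_distinct dist1].
      + by move=> C /cov1; apply: eq_covered.
      + rewrite -[nmem _ _ _]/(nmem s3 aFound 0) ef3 => /fnd1.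
        exact: eq_covered.
      + rewrite -[nmem _ _ _]/(nmem s3 aFound 0) ef3 => /nfnd1 hn q hq.
        rewrite -[row _ q]/(row s3 q) er3.
        by have [->//|qt] := eqVneq q (hi + t); apply: hn; lia.
      + exact: eq_same_rows same1.
    move=> sc; apply: runs_nset_seq => /=.
    set s4 := State _ _.
    have upd_ok s5 : row s5 (hi + t) = cand s ->
        rmem s5 rRev (hi + t) = revI (cand s) ->
        (forall q, q != hi + t -> row s5 q = row s1 q /\
           rmem s5 rRev q = rmem s1 rRev q) ->
        nmem s5 aFound 0 = 1 ->
        (rmem s1 rRev (hi + t) <= revI (cand s))%R ->
        [/\ rows_ok j.+1 hi top s5 /\ rows_distinct j hi top s5,
          forall C, covered j hi top s C -> covered j hi top s5 C,
          nmem s5 aFound 0 != 0 -> covered j hi top s5 (cand s),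
          nmem s5 aFound 0 = 0 -> forall q, hi <= q < hi + t.+1 ->
            ~~ sameI j (row s5 q) (cand s) &
          same_rows hi s s5].
      move=> r5 v5 o5 -> le5; split=> //.
      + split; first exact: (replace_row_ok ok1 r5 v5 o5).
        exact: (replace_row_distinct dist1 r5 o5).
      + move=> C /cov1; apply: (replace_row_covered r5 o5) => //.
        by rewrite -(ok1 _ rlh).2.
      + by move=> _; exists (hi + t); rewrite r5 same_cuts_refl lexx.
      + move=> q qhi; have qne : q != hi + t by lia.
        by have [-> ->] := o5 _ qne; apply: same1.
    apply: runs_if => /=; rewrite /upd /= ea3 eval3 ev3.
      move=> le5.
      have em4 : nmem s4 aM 0 = m by exact: env_m es3.
      have eb4 : nmem s4 aRB 0 = m * (hi + t) by [].
      apply: runs_seq; first exact: (storeP em4 eb4).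
      move=> s5 ag5 [r5 o5]; apply: runs_rset.
      have ea5 : nmem s5 aR 0 = hi + t by rewrite ag5.1.
      have ev5 : rmem s5 rVal 0 = revI (cand s) by rewrite ag5.2.
      apply: upd_ok => //=.
      + by rewrite -[LHS]/(row s5 _) r5 -[LHS]/(cand s3).
      + by rewrite /upd /= ea5 eqxx.
      + move=> q qne; rewrite -[row _ q]/(row s5 q) o5 // /upd /= ea5 (negbTE qne).
        by rewrite ag5.2 // -[row s4 q]/(row s3 q) er3 -ev3.
      + by rewrite /upd /= ag5.1.
    (* The equivalent row is strictly better and is itself the cover of the candidate. *)
    rewrite -ltNge => lt5; apply: runs_skip; split=> //.
    + by split; [apply: eq_rows_ok ok1|apply: eq_rows_distinct dist1].
    + by move=> C /cov1; apply: eq_covered.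
    + move=> _; exists (hi + t); rewrite -[row _ _]/(row s3 (hi + t)) er3; split=> //.
      by rewrite -(ok1 _ rlh).2 ltW.
    + exact: eq_same_rows same1.
  - rewrite /upd /= ehi -/top => s1 _; rewrite subnKC //.
move=> s1 ag [[ok1 dist1] cov1 fnd1 nfnd1 same1].
have es1 : env s1 by apply: env_agree ag _ _ _.
have et1 : nmem s1 aTop 0 = top by rewrite ag.1.
have ec1 : cand s1 = cand s by rewrite (cand_agree ag).
apply: runs_if => /=; rewrite leqn0; last first.
  by move=> f1; apply: runs_skip; split; rewrite ?et1 //; apply: fnd1.
move=> /eqP/nfnd1 nf.
apply: runs_seq; first exact: (mul_mP _ _ (env_m es1)).
move=> s2 ag2; rewrite et1 => eb2.
have em2 : nmem s2 aM 0 = m by rewrite ag2.1 // env_m.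
apply: runs_seq; first exact: (storeP em2 eb2).
move=> s3 ag3 [r3 o3].
have et3 : nmem s3 aTop 0 = top by rewrite ag3.1 // ag2.1.
have ev3 : rmem s3 rVal 0 = revI (cand s) by rewrite ag3.2 // ag2.2 // ag.2.
have eR3 q : rmem s3 rRev q = rmem s1 rRev q by rewrite ag3.2 // ag2.2.
apply: runs_rset_seq; apply: runs_nset; rewrite /= et3 ev3 addn1.
set s4 := State _ _.
have r4 : row s4 top = cand s.
  by rewrite -[LHS]/(row s3 top) r3 (cand_agree ag2).
have v4 : rmem s4 rRev top = revI (cand s) by rewrite /= /upd /= eqxx.
have o4 q : q != top -> row s4 q = row s1 q /\ rmem s4 rRev q = rmem s1 rRev q.
  move=> qt; rewrite -[row s4 q]/(row s3 q) o3 // (row_agree _ ag2) //.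
  by rewrite /= /upd /= (negbTE qt).
have et4 : nmem s4 aTop 0 = top.+1 by [].
split; rewrite ?et4.
- exact: leqW.
- split; first exact: (append_row_ok ok1 r4 v4 o4).
  exact: (append_row_distinct dist1 r4 o4 erefl nf).
- by move=> C /cov1; apply: (append_row_covered o4).
- by exists top; rewrite r4 same_cuts_refl lexx htop ltnSn.
- move=> q qhi; have qt : q != top by lia.
  by have [-> ->] := o4 _ qt; apply: same1.
Qed.

Definition extend (j : 'I_m) (b : nat) (A : {set 'I_m}) : {set 'I_m} :=
  if b != 0 then j |: A else A.

Lemma extend_sub (j : 'I_m) b (A : {set 'I_m}) :
  A \subset prefix_set m j -> extend j b A \subset prefix_set m j.+1.
Proof.
move=> sA; have sA' : A \subset prefix_set m j.+1.
  by apply: subset_trans sA _; apply/subsetP=> t; rewrite !inE; apply: leqW.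
by rewrite /extend; case: ifP => // _; rewrite subUset sA' andbT sub1set inE.
Qed.

Lemma try_bitP (j : 'I_m) hi q b s : env s -> nmem s iJ 0 = j ->
  nmem s aHi 0 = hi -> nmem s aQB 0 = m * q -> row s q \subset prefix_set m j ->
  hi <= nmem s aTop 0 -> rows_ok j.+1 hi (nmem s aTop 0) s ->
  rows_distinct j hi (nmem s aTop 0) s ->
  runs B (try_bit b) s (inserted j hi (extend j b (row s q)) s).
Proof.
move=> es ej ehi eq sq htop ok dist.
apply: runs_seq; first exact: (loadP (env_m es) eq).
move=> s1 ag1 c1; apply: runs_nset_seq => /=; set s2 := State _ _.
have ej1 : nmem s1 iJ 0 = j by rewrite ag1.1.
have es2 : env s2 by apply: env_set => //; apply: env_agree ag1 _ _ _.
have c2 : cand s2 = extend j b (row s q).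
  apply/setP=> x; rewrite inE /= /upd /= ej1 (inj_eq val_inj).
  have e9 : (nmem s1 aCand x != 0) = (x \in row s q) by rewrite -c1 inE.
  rewrite /extend; case: (eqVneq x j) => [->|xj]; case: (b != 0).
  - by rewrite setU11.
  - by apply/esym/negbTE/negP=> /(subsetP sq); rewrite inE ltnn.
  - by rewrite in_setU1 (negbTE xj) e9.
  - exact: e9.
apply: runs_seq; first exact: (cand_revenueP es2).
move=> s3 ag3 v3.
have er q' : row s3 q' = row s q'.
  by rewrite (row_agree _ ag3) // -[LHS]/(row s1 q') (row_agree _ ag1).
have ev q' : rmem s3 rRev q' = rmem s rRev q' by rewrite ag3.2 // ag1.2.
have et : nmem s3 aTop 0 = nmem s aTop 0.
  by rewrite ag3.1 //; exact: ag1.1.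
have ec : cand s3 = extend j b (row s q) by rewrite (cand_agree ag3) // c2.
apply: runs_mono (@insertP j hi s3 _ _ _ _ _ _ _ _).
- move=> s4 _ [h1 h2 h3 h4 h5]; split=> //; last 2 first.
  + by rewrite -ec.
  + by move=> q' /h5[-> ->]; rewrite er ev.
  move=> C cC; apply: h3; rewrite et; exact: eq_covered cC.
- exact: env_agree ag3 _ _ _.
- by rewrite ag3.1.
- by rewrite ag3.1 //= /upd /= ag1.1.
- by rewrite et.
- by rewrite et; apply: eq_rows_ok ok.
- by rewrite et; apply: eq_rows_distinct dist.
- by rewrite ec extend_sub.
- by rewrite v3 (cand_agree ag3).
Qed.

(** The invariant between stages. Of the distinctness of the rows only the resulting bound on their
    number is kept, since the next stage compares sets at another edge. *)
Definition complete j s : Prop :=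
  let lo := nmem s aLo 0 in let hi := nmem s aHi 0 in
  [/\ env s, nmem s aTop 0 = hi, hi - lo <= B, rows_ok j lo hi s &
      forall A : {set 'I_m}, A \subset prefix_set m j ->
        exists2 q, lo <= q < hi & domI j (row s q) A].

Lemma stageP (j : 'I_m) s : nmem s iJ 0 = j -> complete j s ->
  runs B stage s (complete j.+1).
Proof.
move=> ej; rewrite /complete; set lo := nmem s aLo 0; set hi := nmem s aHi 0.
move=> [es etop lenB ok dom].
apply: (@runs_seq _ _ _ _ _ (fun s1 => let top := nmem s1 aTop 0 in
  [/\ hi <= top, rows_ok j.+1 hi top s1, rows_distinct j hi top s1 &
      forall q b, lo <= q < hi -> b < 2 ->
        covered j hi top s1 (extend j b (row s q))])).
  apply: (@runs_for _ _ _ _ _ _ _ (fun t s1 => let top := nmem s1 aTop 0 in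
    [/\ hi <= top, rows_ok j.+1 hi top s1, rows_distinct j hi top s1,
        same_rows hi s s1 &
        forall q b, lo <= q < lo + t -> b < 2 ->
          covered j hi top s1 (extend j b (row s q))])) => //=.
  - rewrite /upd /= etop; split=> //.
    + by move=> q; lia.
    + by move=> q q'; lia.
    + by move=> q b; lia.
  - move=> t s1 tlt vt ag [le1 ok1 dist1 same1 cov1].
    have elo1 : nmem s1 aLo 0 = lo by rewrite ag.1.
    have ehi1 : nmem s1 aHi 0 = hi by rewrite ag.1.
    have ej1 : nmem s1 iJ 0 = j by rewrite ag.1.
    have qhi : lo + t < hi by lia.
    have es1 : env s1 by apply: env_agree ag _ _ _.
    apply: runs_nset_seq; rewrite /= elo1 vt; set s1' := State _ _.
    have es1' : env s1' by apply: env_set.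
    apply: runs_seq; first exact: (mul_mP _ _ (env_m es1')).
    move=> s2 ag2; rewrite -[nmem s1' aQ 0]/(lo + t) => eb2.
    have es2 : env s2 by apply: env_agree ag2 _ _ _.
    have er2 q : row s2 q = row s1 q by rewrite (row_agree _ ag2).
    have ev2 q : rmem s2 rRev q = rmem s1 rRev q by rewrite ag2.2.
    have et2 : nmem s2 aTop 0 = nmem s1 aTop 0 by rewrite ag2.1.
    have eq2 : row s2 (lo + t) = row s (lo + t) by rewrite er2 (same1 _ qhi).1.
    have sq : row s (lo + t) \subset prefix_set m j by apply: (ok _ _).1; lia.
    apply: runs_seq; first apply: (@try_bitP j hi (lo + t) 0 s2) => //.
    + by rewrite ag2.1.
    + by rewrite ag2.1.
    + by rewrite eq2.
    + by rewrite et2.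
    + by rewrite et2; apply: eq_rows_ok ok1.
    + by rewrite et2; apply: eq_rows_distinct dist1.
    move=> s3 ag3 [le3 [ok3 dist3] cov3 new3 same3].
    have eq3 : row s3 (lo + t) = row s (lo + t) by rewrite (same3 _ qhi).1.
    apply: runs_mono (@try_bitP j hi (lo + t) 1 s3 _ _ _ _ _ le3 ok3 dist3).
    + move=> s4 ag4 [le4 [ok4 dist4] cov4 new4 same4]; split=> //.
        move=> q qh; have [h1 h2] := same4 q qh; have [h3 h4] := same3 q qh.
        rewrite -[row _ q]/(row s4 q) h1 h3 er2 /= h2 h4 ev2; exact: same1.
      move=> q b qlo b2.
      have [qt|qt] := eqVneq q (lo + t).
        case: b b2 => [_|[_|//]]; rewrite qt.
          by apply: cov4; rewrite -eq2.
        by rewrite -eq3.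
      apply: cov4; apply: cov3; rewrite et2.
      apply: (eq_covered (s := s1)) => //; apply: cov1 => //; lia.
    + exact: env_agree ag3 _ _ _.
    + by rewrite ag3.1 // ag2.1.
    + by rewrite ag3.1 // ag2.1.
    + by rewrite ag3.1.
    + by rewrite eq3.
  - move=> s1 _ [h1 h2 h3 _ h4]; split=> // q b hq; apply: h4; lia.
move=> s1 ag [le1 ok1 dist1 cov1].
have ehi1 : nmem s1 aHi 0 = hi by rewrite ag.1.
have es1 : env s1 by apply: env_agree ag _ _ _.
apply: runs_nset_seq; apply: runs_nset; set s2 := State _ _.
have es2 : env s2 by do 2!(apply: env_set => //).
have lo2 : nmem s2 aLo 0 = hi by [].
rewrite /complete lo2 -[nmem s2 aHi 0]/(nmem s1 aTop 0).
split=> //.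
- apply: (@distinctB j (fun q => row s1 (hi + q))) => q q' h1 h2.
  by apply: dist1; lia.
- move=> A sA.
  (* A chain of two dominations: an old row dominates [A :\ j], hence its extension by the bit of
     [j] dominates [A]; the new row covering this extension dominates it in turn. *)
  have sA' : A :\ j \subset prefix_set m j.
    apply/subsetP=> t /setD1P[tj /(subsetP sA)]; rewrite !inE ltnS leq_eqVlt.
    by rewrite (inj_eq val_inj) (negbTE tj).
  have [q qlh dq] := dom _ sA'.
  have [r [rlh sr lr]] := cov1 q (j \in A : nat) qlh (leq_b1 _).
  exists r => //; apply: dominates_trans (_ : domI j.+1 (extend j (j \in A) (row s q)) A).
    apply: same_cuts_dominates => //; first by apply/extend_sub/(ok _ qlh).1.
    exact: (ok1 _ rlh).1.
  by apply: dominates_extend => //; case: (j \in A).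
Qed.

Lemma select_bestP s : complete m s ->
  runs B select_best s (fun s' => let A := nzset m (nmem s' aOut) in
    rmem s' 0 0 = revI A /\ forall C : {set 'I_m}, (revI C <= revI A)%R).
Proof.
rewrite /complete; set lo := nmem s aLo 0; set hi := nmem s aHi 0.
move=> [es _ lenB ok dom]; apply: runs_rset_seq.
have domT (C : {set 'I_m}) : exists2 q, lo <= q < hi & (revI C <= revI (row s q))%R.
  have /dom[q qlh dq] : C \subset prefix_set m m by apply/subsetP=> t; rewrite inE.
  by exists q => //; have := dq set0 (sub0set _); rewrite !setU0.
(* Before the first round no set has been output, so only the starting value 0 is known. Revenues
   are nonnegative, hence the first row passes the test and is output. *)
apply: (@runs_for _ _ _ _ _ _ _ (fun t s1 =>
  if t == 0 then rmem s1 0 0 = 0%R else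
  rmem s1 0 0 = revI (nzset m (nmem s1 aOut)) /\
  forall q, lo <= q < lo + t -> (revI (row s q) <= rmem s1 0 0)%R)) => //=.
- move=> t s1 tlt vt ag js.
  have elo1 : nmem s1 aLo 0 = lo by rewrite ag.1.
  have er1 q : row s1 q = row s q by rewrite (row_agree _ ag).
  have ev1 q : rmem s1 rRev q = rmem s rRev q by rewrite ag.2.
  have em1 : nmem s1 aM 0 = m by rewrite ag.1 //; exact: env_m es.
  have qlh : lo <= lo + t < hi by lia.
  apply: runs_nset_seq; rewrite /= elo1 vt; set s1' := State _ _.
  apply: runs_if => /=; rewrite {1}/upd /= ev1 (ok _ qlh).2.
    move=> le1.
    have em1' : nmem s1' aM 0 = m by [].
    apply: runs_seq; first exact: (mul_mP _ _ em1').
    move=> s2 ag2; rewrite -[nmem s1' aQ 0]/(lo + t) => eb2.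
    apply: runs_rset_seq; set s3 := State _ _.
    have em3 : nmem s3 aM 0 = m by rewrite /= ag2.1.
    have r3 : rmem s3 0 0 = revI (row s (lo + t)).
      have eQ2 : nmem s2 aQ 0 = lo + t by exact: ag2.1.
      have eR2 q : rmem s2 rRev q = rmem s rRev q.
        by rewrite ag2.2 //; exact: ev1.
      by rewrite /= /upd /= eQ2 eR2 (ok _ qlh).2.
    apply: runs_mono (outputP em3 eb2) => s4 ag4 o4.
    have er3 : row s3 (lo + t) = row s (lo + t).
      by rewrite -[LHS]/(row s2 (lo + t)) (row_agree _ ag2) //; exact: er1.
    have e4 : rmem s4 0 0 = revI (row s (lo + t)) by rewrite ag4.2.
    split; first by rewrite /= e4 -er3 -o4.
    move=> q hq; rewrite /= e4; have [->|qt] := eqVneq q (lo + t); first by [].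
    move: js; case: eqP => [t0|_ [_ js]]; first by lia.
    by apply: le_trans le1; apply: js; lia.
  rewrite -ltNge => lt1; apply: runs_skip => /=.
  have rge : (0 <= revI (row s (lo + t)))%R by exact: set_rev_ge0.
  move: js; case: eqP => [_ js|_ [js1 js2]].
    by rewrite js ltNge rge in lt1.
  split=> // q hq; have [->|qt] := eqVneq q (lo + t); first exact: ltW.
  by apply: js2; lia.
- move=> s1 _; case: eqP => [e0|_ [e1 e2]].
    by have [q qlh _] := domT set0; lia.
  split=> // C; have [q qlh leC] := domT C.
  by rewrite -e1; apply: le_trans leC (e2 _ _); lia.
Qed.

Lemma fza_prog_no_commodity C s : nmem s 0 1 = 0 ->
  runs C fza_prog s (fun s' => rmem s' 0 0 = 0%R).
Proof. by move=> e; apply: runs_if => /=; rewrite e // => _; apply: runs_rset. Qed.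

Lemma fza_progP s : nmem s 0 0 = m.+1 -> nmem s 0 1 = k ->
  (forall x, nmem s aU x = u x) -> (forall x, nmem s aInc x = inc x) ->
  (forall x, rmem s rF x = f x) -> (forall x, rmem s rW x = w x) ->
  (forall x, nmem s aRow x = 0) -> (forall x, nmem s aCand x = 0) -> 0 < k ->
  runs B fza_prog s (fun s' => let A := nzset m (nmem s' aOut) in
    rmem s' 0 0 = revI A /\ forall C : {set 'I_m}, (revI C <= revI A)%R).
Proof.
move=> em ek eu einc ef ew erow ecand k0.
apply: runs_if => /=; rewrite ek leqn0.
  by rewrite (gtn_eqF k0).
move=> _; do 5!apply: runs_nset_seq; set s0 := State _ _.
have es0 : env s0.
  by split=> //=; rewrite /upd /= em subn1.
apply: runs_seq; first exact: (cand_revenueP es0).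
move=> s1 ag1 v1; apply: runs_rset_seq; set s2 := State _ _.
have es1 : env s1 by apply: env_agree ag1 _ _ _.
(* Cells that hold no input read as 0, so the candidate and row 0 already represent the empty set,
   the only cut set of no edges. *)
have c0 : cand s0 = set0 by apply/setP=> x; rewrite !inE /= /upd /= ecand.
have r0 : row s2 0 = set0.
  by apply/setP=> x; rewrite !inE /= ag1.1 //= /upd /= erow.
have lo2 : nmem s2 aLo 0 = 0 by rewrite /= ag1.1.
have hi2 : nmem s2 aHi 0 = 1 by rewrite /= ag1.1.
have top2 : nmem s2 aTop 0 = 1 by rewrite /= ag1.1.
have B0 : 0 < B by apply: leq_trans kB.
have cpl : complete 0 s2.
  split; rewrite ?lo2 ?hi2 //.
  - by case: es1 => h1 h2 h3 h4 h5 h6; split.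
  - move=> [|//] _; rewrite r0 sub0set; split=> //.
    by rewrite /= /upd /= v1 c0.
  - move=> A sA; exists 0 => //; rewrite r0.
    have -> : A = set0.
      by apply/setP=> x; rewrite inE; apply/negbTE/negP=> /(subsetP sA); rewrite inE.
    exact: dominates_refl.
apply: (@runs_seq _ _ _ _ _ (complete m)); last first.
  by move=> s3 _ /select_bestP.
have em2 : nmem s2 aM 0 = m by exact: env_m es1.
apply: (@runs_for _ _ _ _ _ _ _ (fun t s1 => complete t s1)) => //=.
- by rewrite -[nmem s1 3 0]/(nmem s2 aM 0) em2.
- by case: cpl => h1 h2 h3 h4 h5; split=> //; do 2!(apply: env_set => //).
- rewrite -[nmem s1 3 0]/(nmem s2 aM 0) em2 => j s3 jm vj ag c3.
  apply: runs_mono (@stageP (Ordinal jm) s3 vj c3) => s4 _ [h1 h2 h3 h4 h5].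
  by split=> //; apply: env_set.
- by rewrite -[nmem s1 3 0]/(nmem s2 aM 0) em2.
Qed.
End Spec.

(** * Correctness on path instances *)

Local Open Scope ring_scope.

(** * Edges of walks and their positions *)

Section WalkEdges.
Variable V : finType.
Implicit Types (x y z : V) (s p : seq V).

Lemma size_walk_edges s : size (walk_edges s) = (size s).-1.
Proof. by rewrite size_map size_zip size_behead; apply/minn_idPr; exact: leq_pred. Qed.

Lemma nth_walk_edges x0 s t : (t < (size s).-1)%N ->
  nth set0 (walk_edges s) t = [set nth x0 s t; nth x0 s t.+1].
Proof.
move=> ts; have sz : size (zip s (behead s)) = (size s).-1.
  by rewrite -size_walk_edges size_map.
by rewrite (nth_map (x0, x0)) ?sz // nth_zip_cond sz ts /= nth_behead.
Qed.

Lemma mem_walk_edges x p e : e \in walk_edges (x :: p) ->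
  exists y z, [/\ y \in x :: p, z \in x :: p & e = [set y; z]].
Proof.
elim: p x => [//|y p IH] x; rewrite inE => /orP[/eqP->|/IH[y' [z' [h1 h2 ->]]]].
  by exists x, y; rewrite !inE !eqxx orbT.
by exists y', z'; split=> //; rewrite inE ?h1 ?h2 orbT.
Qed.

(** A discrete intermediate value argument: if [pr] is not constant along the walk, some step
    changes it. *)
Lemma walk_edges_crossing (adj : rel V) (pr : pred V) x p : path adj x p ->
  has pr (x :: p) -> has (predC pr) (x :: p) ->
  exists y z, [/\ adj y z, pr y != pr z & [set y; z] \in walk_edges (x :: p)].
Proof.
elim: p x => [|y p IH] x /=.
  by rewrite !orbF => _ ->.
case/andP=> axy pyp h1 h2.
have [e|ne] := eqVneq (pr x) (pr y).
  have [||y' [z' [a1 a2 a3]]] := IH y pyp.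
  - by move: h1; rewrite /= e orbA orbb.
  - by move: h2; rewrite /= e orbA orbb.
  by exists y', z'; split=> //; rewrite inE a3 orbT.
by exists x, y; split=> //; rewrite inE eqxx.
Qed.

Lemma index_walk_edge s t x y : uniq s -> (t < (size s).-1)%N ->
  [set x; y] = nth set0 (walk_edges s) t ->
  x != y -> (index x s = t /\ index y s = t.+1) \/ (index x s = t.+1 /\ index y s = t).
Proof.
move=> us ts; have ts1 : (t.+1 < size s)%N by rewrite -ltn_predRL.
rewrite (nth_walk_edges x) // => /setP e xy.
have i1 : index (nth x s t) s = t by rewrite index_uniq // ltnW.
have i2 : index (nth x s t.+1) s = t.+1 by rewrite index_uniq.
move: (nth x s t) (nth x s t.+1) e i1 i2 => a b e i1 i2.
have := e x; have := e y; rewrite !inE !eqxx orbT /=.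
move=> /esym/orP[]/eqP ey /esym/orP[]/eqP ex; rewrite ex ey ?eqxx // in xy *.
- by right.
- by left.
Qed.

Lemma uniq_walk_edges s : uniq s -> uniq (walk_edges s).
Proof.
case: s => [|x0 s'] // us; apply/(uniqP set0) => t t'.
rewrite !inE size_walk_edges => ht ht'.
have lt1 : (t < (size (x0 :: s')))%N by move: ht => /=; lia.
have lt2 : (t.+1 < (size (x0 :: s')))%N by move: ht => /=; lia.
rewrite {1}(nth_walk_edges x0) // => e.
have ne : nth x0 (x0 :: s') t != nth x0 (x0 :: s') t.+1.
  by rewrite nth_uniq // neq_ltn ltnSn.
have := index_walk_edge us ht' e ne; rewrite !index_uniq //; lia.
Qed.

End WalkEdges.

(** * Path instances in terms of edge positions *)

Section Instance.
Variables (R : realType) (I : fza_path R).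

Local Notation n := (fza_n I).
Local Notation k := (fza_k I).
Local Notation es := (edges I).
Local Notation m := (size (edges I)).

Lemma size_vs : size (fp_vs I) = n.
Proof.
rewrite /fza_n cardT -(card_uniqP (fp_uniq I)) cardE.
by congr (size _); apply: eq_enum => x; rewrite fp_all.
Qed.

Lemma n_gt0 : (0 < n)%N.
Proof. by case: (fza_treeP I). Qed.

Lemma n_edges : n = m.+1.
Proof. by rewrite size_walk_edges size_vs prednK // n_gt0. Qed.

Lemma uniq_edges : uniq es.
Proof. exact: uniq_walk_edges (fp_uniq I). Qed.

Lemma mem_fza_E e : (e \in fza_E I) = (e \in es).
Proof. by rewrite fp_edges inE. Qed.

Lemma adj_mem_E x y : fza_adj x y -> [set x; y] \in fza_E I.
Proof. by move=> a; apply/imsetP; exists (x, y); rewrite ?inE. Qed.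

Lemma path_sub_E (i : 'I_k) : fza_P i \subset fza_E I.
Proof.
have [x [p [_ pp _ ->]]] := fza_PP i.
apply/subsetP=> e; rewrite inE.
elim: p x pp => [|y p IH] x //= /andP[axy pyp]; rewrite inE => /orP[/eqP->|].
  exact: adj_mem_E.
exact: IH.
Qed.

Lemma path_neq0 (i : 'I_k) : fza_P i != set0.
Proof.
have [x [p [p0 _ _ ->]]] := fza_PP i.
case: p p0 => [//|y p] _; apply/set0Pn; exists [set x; y].
by rewrite inE inE eqxx.
Qed.

(** Edge [t] joins the vertices at positions [t] and [t + 1]. The walk of the commodity visits an
    end of edge [a], at position at most [b], and an end of edge [c], at position above [b]. Some
    step crosses this threshold, and edge [b] is the only edge that does. *)
Lemma path_interval (i : 'I_k) (a b c : nat) : (a < b)%N -> (b < c)%N -> (c < m)%N ->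
  nth set0 es a \in fza_P i -> nth set0 es c \in fza_P i ->
  nth set0 es b \in fza_P i.
Proof.
move=> ab bc cm; have [x [p [_ pp _ ->]]] := fza_PP i.
have sz : m = (size (fp_vs I)).-1 by rewrite size_walk_edges.
rewrite !inE => ha hc.
have idx y t : (t < m)%N -> y \in nth set0 es t -> (t <= index y (fp_vs I) <= t.+1)%N.
  move=> tm; rewrite sz in tm; rewrite (nth_walk_edges x) //.
  rewrite ltn_predRL in tm.
  by move=> /set2P[]->; rewrite index_uniq ?fp_uniq ?leqnn ?leqnSn // ltnW.
have pick t : nth set0 es t \in walk_edges (x :: p) ->
    exists2 y, y \in x :: p & y \in nth set0 es t.
  by case/mem_walk_edges=> y [z [h1 _ ->]]; exists y => //; rewrite set21.
have [y yp /idx hy] := pick _ ha; have [z zp /idx hz] := pick _ hc.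
have [||y' [z' [adj ne hyz]]] :=
    @walk_edges_crossing _ _ (fun v => (index v (fp_vs I) <= b)%N) x p pp.
- by apply/hasP; exists y => //; have := hy; lia.
- by apply/hasP; exists z => //=; rewrite -ltnNge; have := hz cm; lia.
have := adj_mem_E adj; rewrite mem_fza_E => /(nthP set0)[t tm et].
have ts : (t < (size (fp_vs I)).-1)%N by rewrite -sz.
have yz : y' != z' by apply: contraNneq ne => ->.
have := index_walk_edge (fp_uniq I) ts (esym et) yz.
suff: t = b -> nth set0 es b \in walk_edges (x :: p).
  by move=> hb [] [h3 h4]; apply: hb; move: ne; rewrite h3 h4;
    case: leqP; case: leqP => //; lia.
by move=> <-; rewrite et.
Qed.

Definition idx_set (F : {set {set fza_V I}}) : {set 'I_m} :=
  [set t : 'I_m | nth set0 es t \in F].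

Lemma card_idx_set (F : {set {set fza_V I}}) : F \subset fza_E I -> #|idx_set F| = #|F|.
Proof.
move=> sF.
have inj : injective (fun t : 'I_m => nth set0 es t).
  move=> t t' e; apply/val_inj/eqP.
  by rewrite -(nth_uniq set0 (ltn_ord t) (ltn_ord t') uniq_edges) e.
rewrite -(card_imset _ inj); congr #|pred_of_set _|; apply/setP=> e.
apply/imsetP/idP=> [[t]|eF]; first by rewrite inE => ? ->.
have := subsetP sF _ eF; rewrite mem_fza_E => /(nthP set0)[t tm et].
by exists (Ordinal tm) => //; rewrite inE /= et.
Qed.

Lemma idx_setI F G : idx_set (F :&: G) = idx_set F :&: idx_set G.
Proof. by apply/setP=> t; rewrite !inE. Qed.

Local Notation s0 := (init (fza_input I)).
Local Notation u0 := (nmem s0 1).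
Local Notation inc0 := (nmem s0 2).
Local Notation f0 := (rmem s0 0%N).
Local Notation w0 := (rmem s0 1%N).

Lemma nth_allpairs_row (T U : Type) (h : T -> U -> nat) (xs : seq T) (ys : seq U)
    x0 y0 i t : (i < size xs)%N -> (t < size ys)%N ->
  nth 0%N [seq h x y | x <- xs, y <- ys] (size ys * i + t) =
  h (nth x0 xs i) (nth y0 ys t).
Proof.
move=> + tys; elim: xs i => [//|x xs IH] [|i] /=.
  by rewrite muln0 add0n nth_cat size_map tys (nth_map y0).
rewrite ltnS nth_cat size_map mulnS => ixs.
by rewrite -addnA ltnNge leq_addr /= addKn IH.
Qed.

Lemma inc0E (i : 'I_k) (t : 'I_m) :
  inc0 (m * i + t) = (nth set0 es t \in fza_P i) :> nat.
Proof.
rewrite /= (nth_allpairs_row _ i set0) ?size_enum_ord //.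
by rewrite nth_ord_enum.
Qed.

Lemma pedges_idx (i : 'I_k) : pedges m inc0 i = idx_set (fza_P i).
Proof. by apply/setP=> t; rewrite !inE inc0E; case: (_ \in _). Qed.

Lemma cuts_idx (i : 'I_k) F : cuts inc0 i (idx_set F) = #|fza_P i :&: F|.
Proof.
rewrite /cuts pedges_idx -idx_setI card_idx_set //.
exact: subset_trans (subsetIl _ _) (path_sub_E i).
Qed.

Lemma u0E (i : 'I_k) : u0 i = fza_u i.
Proof. by rewrite /= (nth_map i) ?size_enum_ord // nth_ord_enum. Qed.

Lemma w0E (i : 'I_k) : w0 i = (fza_w i)%:R.
Proof. by rewrite /= (nth_map i) ?size_enum_ord // nth_ord_enum. Qed.

Lemma f0E x : (x < n)%N -> f0 x = fza_f I x.
Proof. by move=> xn; rewrite /= (nth_map 0%N) ?size_iota // nth_iota. Qed.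

Lemma set_rev_idx F : set_rev k u0 inc0 f0 w0 (idx_set F) = revenue F.
Proof.
apply: eq_bigr => i _; rewrite /set_rev_i /com_rev cuts_idx u0E w0E f0E //.
(* At most [m] edges are cut and [m < n], so only tabulated values of [f] are read. *)
by rewrite -cuts_idx n_edges ltnS -[X in (_ <= X)%N]card_ord max_card.
Qed.

Lemma f0_ge0 x : 0 <= f0 x.
Proof.
have [xn|xn] := ltnP x n; first by rewrite f0E // fza_f_ge0.
by rewrite /= nth_default // size_map size_iota.
Qed.

Lemma w0_ge0 x : 0 <= w0 x.
Proof.
have [xk|xk] := ltnP x k; first by rewrite (w0E (Ordinal xk)) ler0n.
by rewrite /= nth_default // size_map size_enum_ord.
Qed.

Lemma card_commodities_le (t : 'I_m) :
  (#|[set i : 'I_k | inc0 (m * i + t) != 0%N]| <= cong I)%N.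
Proof.
rewrite (eq_card (B := [set i | nth set0 es t \in fza_P i])); last first.
  by move=> i; rewrite !inE inc0E; case: (_ \in _).
by apply: (leq_bigmax_cond (P := mem (fza_E I))); rewrite /= mem_fza_E mem_nth.
Qed.

(** Double counting of incidences: every path has an edge, and every edge lies on at most [cong I]
    paths. This bounds the loops over commodities in terms of [n] and the congestion. *)
Lemma k_le : (k <= m * cong I)%N.
Proof.
have -> : k = (\sum_(i < k) 1)%N by rewrite sum1_card card_ord.
apply: (@leq_trans (\sum_(i < k) #|idx_set (fza_P i)|)).
  apply: leq_sum => i _.
  by rewrite card_idx_set ?path_sub_E // card_gt0 path_neq0.
under eq_bigr => i _ do rewrite -sum1_card big_mkcond /=.
rewrite exchange_big /= -[X in (_ <= X * _)%N]card_ord -sum_nat_const.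
apply: leq_sum => t _; apply: leq_trans (card_commodities_le t).
rewrite -sum1_card [X in (_ <= X)%N]big_mkcond; apply: leq_sum => i _.
by rewrite !inE inc0E; case: (_ \in _).
Qed.

Lemma idx_set_out s : idx_set (out_solution I s) = nzset m (nmem s 0).
Proof.
apply/setP=> t; rewrite !inE mem_nth // index_uniq ?uniq_edges //.
Qed.

Lemma out_sub s : out_solution I s \subset fza_E I.
Proof. by apply/subsetP=> e; rewrite inE mem_fza_E => /andP[]. Qed.

Lemma opt_eq (F : {set {set fza_V I}}) : F \subset fza_E I ->
  (forall G : {set {set fza_V I}}, G \subset fza_E I -> revenue G <= revenue F) ->
  opt I = (revenue F)%:E.
Proof.
move=> sF hF; apply/le_anti/andP; split; last exact: le_bigmax_cond.
by apply: bigmax_le => [|G sG]; rewrite ?leNye // lee_fin hF.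
Qed.

Lemma fza_prog_correct :
  runs (n ^ (2 * cong I)) fza_prog s0 (fun s =>
    (revenue (out_solution I s))%:E = opt I /\ (out_value s)%:E = opt I).
Proof.
have [k0|k0] := posnP k.
  have r0 (F : {set {set fza_V I}}) : revenue F = 0 :> R.
    by rewrite /revenue big1 // => i _; have := ltn_ord i; rewrite {2}k0.
  have o0 (F : {set {set fza_V I}}) : F \subset fza_E I -> opt I = 0%:E.
    by move=> sF; rewrite (opt_eq sF) ?r0 // => G _; rewrite !r0.
  apply: runs_mono (fza_prog_no_commodity _ _) => // s _ v.
  by rewrite (o0 _ (out_sub s)) r0 /out_value v.
have kc := k_le.
have c0 : (0 < cong I)%N by lia.
have m0 : (0 < m)%N by lia.
have n2 : (1 < n)%N by rewrite n_edges.
have cn : (cong I <= n ^ cong I)%N by apply: ltnW; apply: ltn_expl.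
have nn : (n <= n ^ cong I)%N by rewrite -{1}[n]expn1 leq_pexp2l // ltnW.
(* One factor already bounds [m] and the length of the lists. The second is there for the
   commodities: [k <= m * cong I], where [m] and [cong I] are both at most [n ^ cong I]. *)
have powE : (n ^ (2 * cong I) = n ^ cong I * n ^ cong I)%N.
  by rewrite mul2n -addnn expnD.
have n1 : (0 < n ^ cong I)%N by rewrite expn_gt0 ltnW.
have mn : (m <= n)%N by rewrite n_edges.
apply: runs_mono (@fza_progP R m k _ u0 inc0 f0 w0 _ _ _ _ _ _ s0 _ _ _ _ _ _ _ _ _) => //.
- move=> s _ /= [v mx].
  have opE : opt I = (revenue (out_solution I s))%:E.
    apply: opt_eq (out_sub s) _ => G sG.
    by rewrite -!set_rev_idx idx_set_out; apply: mx.
  by rewrite opE /out_value v -idx_set_out set_rev_idx.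
- rewrite powE; apply: leq_trans mn (leq_trans nn _).
  by rewrite leq_pmulr.
- by rewrite powE; apply: leq_trans kc _; apply: leq_mul => //; apply: leq_trans mn nn.
- move=> j h len hd.
  apply: leq_trans (size_distinct (card_commodities_le j) hd) _.
  by rewrite -n_edges powE leq_pmulr.
- move=> i t1 t2 t3 ik; rewrite (pedges_idx (Ordinal ik)) !inE => a b.
  exact: path_interval.
- exact: f0_ge0.
- exact: w0_ge0.
- exact: n_edges.
- by move=> x; rewrite /= nth_nil.
- by move=> x; rewrite /= nth_nil.
Qed.

(** * The optimum as a maximum over vectors *)

Lemma leftmost_le (i : 'I_k) : (leftmost i <= m)%N.
Proof.
(* The search for an edge of the path succeeds because the path is nonempty; a failure would give
   [m + 1]. *)
rewrite /leftmost -has_find; have [e eP] := set0Pn _ (path_neq0 i).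
by apply/hasP; exists e => //; rewrite -mem_fza_E (subsetP (path_sub_E i)).
Qed.

Lemma cut_ok_exists (u c : nat) : exists x : xdom u, cut_ok c x.
Proof.
have [h|h] := ltnP c u.+2; last by exists None.
(* [Some m] stands for [m - 1], and this must equal [u - c], so [m] is [u + 1 - c]; the subtraction
   is exact as [c] is at most [u + 1]. *)
have lt : (u.+1 - c < u.+2)%N by rewrite ltnS leq_subr.
exists (Some (Ordinal lt)); rewrite /= -subzn //; apply/eqP; lia.
Qed.

(** At the last edge the subinstance is the whole instance, and every solution is compatible with
    some [X], so the right-hand side is the same maximum taken class by class. *)
Lemma opt_max_Rmax : opt I = \big[maxe/-oo%E]_(X : xvec I n.-1) Rmax X.
Proof.
have nm : n.-1 = m by rewrite n_edges.
have preE : prefix_edges I n.-1 = fza_E I.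
  by apply/setP=> e; rewrite inE nm take_size mem_fza_E.
have subE (F : {set {set fza_V I}}) : subrevenue n.-1 F = revenue F.
  by apply: eq_bigl => i; rewrite nm leftmost_le.
apply/le_anti/andP; split.
  apply: bigmax_le => [|F sF]; first by rewrite leNye.
  have [X hX] : exists X : xvec I n.-1, compatible X F.
    have ex (i : active I n.-1) := cut_ok_exists (fza_u (val i))
      #|fza_P (val i) :&: F :&: prefix_edges I n.-1|.
    exists [ffun i => xchoose (ex i)]; apply/forallP=> i.
    by rewrite ffunE; apply: (xchooseP (ex i)).
  apply: (bigmax_sup X) => //; apply: (bigmax_sup F); last by rewrite subE.
  by rewrite preE sF.
apply: bigmax_le => [|X _]; first by rewrite leNye.
apply: bigmax_le => [|F /andP[sF _]]; first by rewrite leNye.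
by rewrite subE; apply: le_bigmax_cond; rewrite -preE.
Qed.

End Instance.

(** * Polynomial time for bounded congestion *)

Lemma fza_prog_poly (R : realType) (I : fza_path R) :
  let c := (time 1 fza_prog + 2 * loop_depth fza_prog)%N in
  exists s t, [/\ exec fza_prog (init (fza_input I)) s t,
    (t <= c * fza_n I ^ (c * cong I))%N,
    (revenue (out_solution I s))%:E = opt I & (out_value s)%:E = opt I].
Proof.
move=> c; have [s [t [ex le [h1 h2]]]] := fza_prog_correct I.
exists s, t; split=> //; have n0 := n_gt0 I.
apply: leq_trans le (leq_trans (time_le_poly _ _) _); first by rewrite expn_gt0 n0.
(* The first summand of [c] bounds the factor [time 1 fza_prog]. The second bounds the exponent: the
   round bound [n ^ (2 * cong)] is raised to the loop depth. *)
rewrite -expnM; apply: leq_mul; first exact: leq_addr.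
rewrite leq_pexp2l // mulnAC leq_mul2r leq_addl orbT //.
Qed.

Theorem theorem7 (R : realType) :
  [/\ forall I : fza_path R, (1 < fza_n I)%N ->
        opt I = \big[maxe/-oo%E]_(X : xvec I (fza_n I).-1) Rmax X,
      exists (p : cmd) (c : nat), forall I : fza_path R,
        exists (s : state R) (t : nat),
          [/\ exec p (init (fza_input I)) s t,
              (t <= c * fza_n I ^ (c * cong I))%N &
              (out_value s)%:E = opt I]
    & in_XP (fza_on_paths R)].
Proof.
pose c := (time 1 fza_prog + 2 * loop_depth fza_prog)%N; split.
- by move=> I _; apply: opt_max_Rmax.
- exists fza_prog, c => I.
  by have [s [t [h1 h2 _ h3]]] := fza_prog_poly I; exists s, t.
- exists fza_prog, (fun l => c + c * l)%N => I.
  have [s [t [h1 h2 h3 _]]] := fza_prog_poly I; exists s, t; split=> //.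
  apply: leq_trans h2 _.
  (* The table of [f] has [n] entries, and two more cells hold [n] and [k]. An input size of at
     least 2 lets its [c]-th power absorb the factor [c]. *)
  have sz : (fza_n I + 2 <= input_size (fza_input I))%N.
    by rewrite /input_size /= !size_map size_iota; lia.
  rewrite expnD; apply: leq_mul.
    by apply: ltnW; apply: ltn_expl; apply: leq_trans sz; rewrite addn2.
  have le_exp a b e : (a <= b -> a ^ e <= b ^ e)%N.
    by case: e => // e ab; rewrite leq_exp2r.
  by apply: le_exp; apply: leq_trans sz; rewrite leq_addr.
Qed.
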